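(* In the network attack model described in the context, suppose that $\lambda$, $\mu$ and $\frac{\lambda}{b}$ are distinct. Then for every $\vartheta\ge0$, $$F_{\tau_\rho}(\vartheta)=P\{\tau_\rho\le\vartheta\}=\lambda(1-K)\sum_{i=0}^{M-1}c_i\,\phi_i(\vartheta)+\lambda e^{-\xi V}\sum_{j=0}^{M-2}\frac{(\xi V)^j}{j!}\sum_{i=0}^{j}d_{j,i}\,\phi_i(\vartheta),$$ where $$K=e^{-\xi V}\sum_{j=0}^{M-2}\frac{(\xi V)^j}{j!},\qquad c_i=\binom{M-1}{i}(a\lambda)^ib^{M-1-i},\qquad d_{j,i}=\binom{j}{i}(a\lambda)^ib^{j-i},$$ $$\phi_i(\vartheta)=\frac{1}{\lambda^{i+1}}\left(1-e^{-\lambda\vartheta}\sum_{r=0}^{i}\frac{(\lambda\vartheta)^r}{r!}\right)-\frac{e^{-\mu\vartheta}}{(\lambda-\mu)^{i+1}}\left(1-e^{-(\lambda-\mu)\vartheta}\sum_{r=0}^{i}\frac{[(\lambda-\mu)\vartheta]^r}{r!}\right).$$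
   Context: Model. Let $\lambda,\mu,\xi>0$, $a\in(0,1)$, $b=1-a$, $M\in\{1,2,3,\dots\}$, $V>0$. Attacks occur at the points $0<t_1<t_2<\cdots$ of a Poisson process of rate $\lambda$ on $[0,\infty)$. The $k$th attack ($k\ge1$) incapacitates $n_k$ nodes of total weight $w_k=w_{k1}+\cdots+w_{kn_k}$, where the $n_k$ are iid geometric, $P(n_k=j)=ab^{j-1}$ for $j\ge1$, and the $w_{kj}$ are iid exponential with rate $\xi$ (mean $1/\xi$). Set $N(t)=\sum_{k:\,t_k\le t}n_k$ and $W(t)=\sum_{k:\,t_k\le t}w_k$ (zero initial state). The process is observed only at times $\tau_0=0<\tau_1<\tau_2<\cdots$, where $\tau_k-\tau_{k-1}$, $k\ge1$, are iid exponential with rate $\mu$. The families $(t_k)$, $(n_k)$, $(w_{kj})$, $(\tau_k-\tau_{k-1})$ are mutually independent. Write $N_k=N(\tau_k)$, $W_k=W(\tau_k)$. The first observed passage index is $$\rho=\inf\{k\ge0:(N_k,W_k)\notin[0,M)\times[0,V)\},$$ and $\tau_\rho$ is the first observed passage time. Conventions: empty sums (as when $M=1$) are $0$, and $x^0=1$ for all real $x$. *)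

(* Defs.v *)
From HB Require Import structures.
From mathcomp Require Import all_boot all_order all_algebra finmap.
From mathcomp Require Import all_classical all_reals all_analysis measurable_realfun.

Set Implicit Arguments.
Unset Strict Implicit.
Unset Printing Implicit Defensive.

Import Order.TTheory GRing.Theory Num.Theory.
Import numFieldNormedType.Exports.

Local Open Scope classical_set_scope.
Local Open Scope ring_scope.

Section independence.
Context {d : measure_display} {T : measurableType d} {R : realType}.
Variable P : probability T R.

Definition mutually_independent (I : choiceType) (F : I -> set_system T) :=
  forall (J : {fset I}) (E : I -> set T),
    (forall i, i \in J -> F i (E i)) ->
    P (\bigcap_(i in [set` J]) E i) = (\prod_(i <- J) P (E i))%E.

Definition independent_rvs {d' : measure_display} {U : measurableType d'}
    (I : choiceType) (X : I -> T -> U) :=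
  mutually_independent (fun i => g_sigma_algebra_preimage (X i)).

(* sigma-algebra generated by a whole family of random variables *)
Definition family_sigma {d' : measure_display} {U : measurableType d'}
    (I : Type) (X : I -> T -> U) : set_system T :=
  <<s \bigcup_(i in [set: I]) g_sigma_algebra_preimage (X i) >>.

(* The law is compared with mu on measurable sets only: the values of P and mu
   elsewhere carry no information. *)
Definition has_law {d' : measure_display} {U : measurableType d'}
    (X : T -> U) (mu : set U -> \bar R) :=
  forall A, measurable A -> P (X @^-1` A) = mu A.

Definition iid_exponential (I : choiceType) (r : R) (X : I -> T -> R) :=
  independent_rvs X /\ forall i, has_law (X i) (exponential_prob r).

(* Geometric law on {1, 2, ...}; the value 0 then has probability 0. *)
Definition iid_geometric (I : choiceType) (a : R) (X : I -> T -> nat) :=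
  independent_rvs X /\
  forall i j, (0 < j)%N ->
    P [set omega | X i omega = j] = (a * (1 - a) ^+ j.-1)%:E.

Definition count_points (t : nat -> T -> R) (s u : R) (omega : T) : \bar R :=
  counting [set k | s < t k omega <= u].

(* t enumerates (t 0 being the first point) the points of a Poisson process of
   rate r on [0, +oo[: independent Poisson increments. *)
Definition poisson_points (r : R) (t : nat -> T -> R) :=
  [/\ {ae P, forall omega,
         0 < t 0%N omega /\ forall k, t k omega < t k.+1 omega},
      forall s u : R, 0 <= s -> s < u -> forall j : nat,
        P [set omega | count_points t s u omega = j%:R%:E] =
          (poisson_pmf (r * (u - s)) j)%:E
    & forall s : nat -> R, 0 <= s 0%N -> (forall i, s i <= s i.+1) ->
        independent_rvs (fun i => count_points t (s i) (s i.+1))].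

End independence.

Section attack_model.
Context {T : Type} {R : realType}.
(* Indices of attacks and of nodes are shifted by one: t k, n k and w k j stand
   for t_(k+1), n_(k+1) and w_(k+1, j+1). The observation times tau k are not
   shifted. *)
Variables (t : nat -> T -> R) (n : nat -> T -> nat) (w : nat -> nat -> T -> R).
Variable tau : nat -> T -> R.

Definition attack_weight (k : nat) (omega : T) : R :=
  \sum_(j < n k omega) w k j omega.

(* Extended-real valued, as the set of attacks before s is only almost surely
   finite. An esum is the supremum of its finite partial sums, hence the sum
   when the terms are nonnegative; for the weights this holds almost surely. *)
Definition nodes_lost (s : R) (omega : T) : \bar R :=
  \esum_(k in [set k | t k omega <= s]) (n k omega)%:R%:E.

Definition weight_lost (s : R) (omega : T) : \bar R :=
  \esum_(k in [set k | t k omega <= s]) (attack_weight k omega)%:E.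

Variables (M : nat) (V : R).

Definition observed_out (omega : T) (k : nat) : Prop :=
  ~ (`[0%:E, M%:R%:E[ `*` `[0%:E, V%:E[)%classic
      (nodes_lost (tau k omega) omega, weight_lost (tau k omega) omega).

(* infimum of a set of naturals, None standing for +oo *)
Definition first_index (Q : nat -> Prop) : option nat :=
  match pselect (exists k, `[< Q k >]) with
  | left h => Some (ex_minn h)
  | right _ => None
  end.

Definition passage_index (omega : T) : option nat :=
  first_index (observed_out omega).

Definition passage_time (omega : T) : \bar R :=
  if passage_index omega is Some k then (tau k omega)%:E else +oo%E.

End attack_model.

Section formula.
Context {R : realType}.
Variables (lambda mu xi a b V : R) (M : nat).

Definition coef_K : R :=
  expR (- (xi * V)) * \sum_(j < M.-1) (xi * V) ^+ j / j`!%:R.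

Definition coef_c (i : nat) : R :=
  'C(M.-1, i)%:R * (a * lambda) ^+ i * b ^+ (M.-1 - i).

Definition coef_d (j i : nat) : R :=
  'C(j, i)%:R * (a * lambda) ^+ i * b ^+ (j - i).

Definition phi (i : nat) (theta : R) : R :=
  1 / lambda ^+ i.+1 *
    (1 - expR (- (lambda * theta)) *
         \sum_(r < i.+1) (lambda * theta) ^+ r / r`!%:R)
  - expR (- (mu * theta)) / (lambda - mu) ^+ i.+1 *
    (1 - expR (- ((lambda - mu) * theta)) *
         \sum_(r < i.+1) ((lambda - mu) * theta) ^+ r / r`!%:R).

End formula.

(* Main.v *)
Require Import Defs.
From HB Require Import structures.
From mathcomp Require Import all_boot all_order all_algebra finmap.
From mathcomp Require Import all_classical all_reals all_analysis measurable_realfun.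
From mathcomp Require Import ring.

(** The losses only grow, so the whole passage is decided by one attack: the
    hitting attack, the first one at which the accumulated number of nodes
    reaches M or the accumulated weight reaches V. If its index is k, the
    process is seen outside at tau_j exactly when t_k <= tau_j, and the passage
    time is at most theta iff some observation falls in [t_k, theta]
    ([passage_time_le_hits]). The index k is a function of the counts and the
    weights, the event about [t_k, theta] one of the attack and the observation
    times, so ([unhit_hits_indep])

      P(passage <= theta) =
        sum_(k < M) P(hitting attack = k) * P(some tau_j is in [t_k, theta]).

    Second factor ([hits_prob]). Observation gaps are memoryless: whichever gap
    contains t_k, its remainder after t_k is again exponential of rate mu and
    independent of t_k ([straddle_weight], [renewal_hits]). Hence the factor is
    the expectation of 1 - exp(- mu (theta - t_k)) on {t_k <= theta}, which
    Tonelli turns into the integral over [0, theta] of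
    mu exp(- mu (theta - u)) P(t_k <= u). Here P(t_k <= u) is the probability of
    more than k Poisson points before u, and the fundamental theorem of calculus
    evaluates the integral to lambda^(k+1) phi_k(theta)
    ([integral_exp_cdf_erlang]).

    First factor ([unhit_prob], [first_passage_sum]). Line up the nodes of all
    attacks in order. The weights make a Poisson(xi V) number of them fit below
    V, so J = min(M - 1, Poisson(xi V)) nodes are lost before the node that
    takes the process outside; a geometric number of nodes per attack means that
    every node is the last one of its attack with probability a, independently.
    So the index of the hitting attack is binomial (J, a). The case J = M - 1,
    of probability 1 - K, produces the coefficients c_i, and the cases
    J = j < M - 1 produce the d_(j,i). The formal derivation computes the tails
    P(hitting attack >= k): conditionally on the counts, the accumulated weight
    is an Erlang variable ([sum_exponential]); the law of the accumulated count
    is read off the powers of a generating polynomial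
    ([sum_geometric_words], [success_tailB]). *)

Set Implicit Arguments.
Unset Strict Implicit.
Unset Printing Implicit Defensive.

Import Order.TTheory GRing.Theory Num.Theory.
Import numFieldNormedType.Exports.

Local Open Scope classical_set_scope.
Local Open Scope ring_scope.

(** * Independence of generated sigma-algebras *)

Section independence_theory.
Context {d : measure_display} {T : measurableType d} {R : realType}.
Variable P : probability T R.

(** The sets independent of B form a Dynkin system, so Dynkin's theorem carries
    independence from a pi-system to the sigma-algebra it generates. *)
Lemma pi_lambda_indep (G : set_system T) (B : set T) :
  setI_closed G -> G `<=` measurable -> measurable B ->
  (forall A, G A -> P (A `&` B) = (P A * P B)%E) ->
  forall A, <<s G >> A -> P (A `&` B) = (P A * P B)%E.
Proof.
move=> GI Gm mB GB A sA.
have PBf : P B \is a fin_num by exact: fin_num_measure.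
suff : [set A | measurable A /\ P (A `&` B) = (P A * P B)%E] A by case.
move: A sA; apply: (lambda_system_subset GI (D := setT)) => //; last first.
  by move=> A GA; split; [exact: Gm|exact: GB].
apply/dynkin_lambda_system; split.
- by split => //; rewrite setTI probability_setT mul1e.
- move=> A [mA AB]; split; first exact: measurableC.
  have AI : A `&` B `<=` B by [].
  have -> : ~` A `&` B = B `\` (A `&` B).
    by apply/seteqP; split=> x /=; [case=> nA ?; split => // -[]
      |case=> xB h; split => // xA; apply: h].
  have Af : P A \is a fin_num by exact: fin_num_measure.
  rewrite measureD //; [|exact: measurableI|by rewrite -ge0_fin_numE].
  rewrite (setIidr AI); transitivity (P B - P A * P B)%E.
    by congr (_ - _)%E; exact: AB.
  rewrite probability_setC//.
  by rewrite muleBl ?mul1e.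
- move=> F tF FH.
  have mF n : measurable (F n) by case: (FH n).
  split; first exact: bigcupT_measurable.
  rewrite setI_bigcupl measure_bigcup//=; last 2 first.
    by move=> n _; exact: measurableI.
    apply/trivIsetP => i j _ _ ij; move/trivIsetP : tF => /(_ i j I I ij) Fij.
    by rewrite setIACA Fij set0I.
  rewrite measure_bigcup//=.
  rewrite -[X in (_ * X)%E]fineK// muleC -nneseriesZl//.
  by apply: eq_eseriesr => n _; rewrite fineK// muleC; case: (FH n).
Qed.

Variables (I : choiceType) (F : I -> set_system T).
Hypothesis Fs : forall i, sigma_algebra setT (F i).
Hypothesis Fm : forall i, F i `<=` measurable.
Hypothesis Find : mutually_independent P F.

Let FT i : F i setT.
Proof. by case: (Fs i) => F0 FC _; rewrite -(setD0 setT); exact: FC. Qed.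

Let FI i A B : F i A -> F i B -> F i (A `&` B).
Proof.
have [F0 FC FU] := Fs i; move=> FA FB.
(* De Morgan: the axioms give only complements and countable unions. *)
have -> : A `&` B = setT `\` \bigcup_k bigcup2 (setT `\` A) (setT `\` B) k.
  by rewrite bigcup2E !setTD setCU !setCK.
by apply/FC/FU => -[|[|k]] //=; exact: FC.
Qed.

(** The sets E i are defined for every i and trivial outside K and J, so that
    two cylinders can be rewritten over a common index set ([cylinder_widen]). *)
Definition cylinder (J : set I) : set_system T :=
  [set A | exists E : I -> set T, exists K : {fset I},
    [/\ forall i, F i (E i),
        forall i, ~ (i \in K /\ J i) -> E i = setT
      & A = \bigcap_(i in [set` K]) E i]].

Lemma cylinder_widen (E : I -> set T) (K K' : {fset I}) :
  (K `<=` K')%fset -> (forall i, i \notin K -> E i = setT) ->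
  \bigcap_(i in [set` K]) E i = \bigcap_(i in [set` K']) E i.
Proof.
move=> KK' KE; apply/seteqP; split=> x /= h i /= iK.
  have [iK1|iK1] := boolP (i \in K); first exact: h.
  by rewrite KE.
by apply: h => /=; exact: (fsubsetP KK').
Qed.

Lemma cylinder_setI J : setI_closed (cylinder J).
Proof.
move=> _ _ [E [K [FE KE ->]]] [E' [K' [FE' KE' ->]]].
have hE i : i \notin K -> E i = setT.
  by move=> iK; apply: KE => -[h]; rewrite h in iK.
have hE' i : i \notin K' -> E' i = setT.
  by move=> iK; apply: KE' => -[h]; rewrite h in iK.
exists (fun i => E i `&` E' i); exists (K `|` K')%fset; split.
- by move=> i; exact: FI.
- move=> i h; rewrite KE ?KE' ?setIT// => -[iK iJ]; apply: h.
    by rewrite inE iK orbT.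
  by rewrite inE iK.
- rewrite (cylinder_widen (fsubsetUl K K') hE).
  by rewrite (cylinder_widen (fsubsetUr K K') hE') -bigcapI.
Qed.

Lemma bigcap_fset_measurable (E : I -> set T) (K : {fset I}) :
  (forall i, measurable (E i)) -> measurable (\bigcap_(i in [set` K]) E i).
Proof.
by move=> mE; apply: fin_bigcap_measurable => //; exact: finite_fset.
Qed.

Lemma cylinder_indep J1 J2 A B : (forall i, ~ (J1 i /\ J2 i)) ->
  cylinder J1 A -> cylinder J2 B -> P (A `&` B) = (P A * P B)%E.
Proof.
move=> J12 [E [K [FE KE ->]]] [E' [K' [FE' KE' ->]]].
have hE i : i \notin K -> E i = setT.
  by move=> iK; apply: KE => -[h]; rewrite h in iK.
have hE' i : i \notin K' -> E' i = setT.
  by move=> iK; apply: KE' => -[h]; rewrite h in iK.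
rewrite (cylinder_widen (fsubsetUl K K') hE).
rewrite (cylinder_widen (fsubsetUr K K') hE') -bigcapI.
rewrite !Find//; last by move=> i _; exact: FI.
rewrite -big_split/=; apply: eq_bigr => i _.
(* At every index one of the two sets is trivial. *)
have [J1i|J1i] := pselect (J1 i).
  have -> : E' i = setT by apply: KE' => -[_ J2i]; exact: (J12 i).
  by rewrite setIT probability_setT mule1.
have -> : E i = setT by apply: KE => -[_].
by rewrite setTI probability_setT mul1e.
Qed.

Lemma sub_cylinder (J : set I) :
  <<s \bigcup_(i in J) F i >> `<=` <<s cylinder J >>.
Proof.
apply: smallest_sub; first exact: smallest_sigma_algebra.
move=> A [i Ji FA]; apply: sub_sigma_algebra.
exists (fun j => if j == i then A else setT); exists [fset i]%fset; split.
- by move=> j; case: eqP => [->|_].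
- by move=> j h; case: eqP => // ji; case: h; rewrite ji inE eqxx.
- apply/seteqP; split=> x /=.
    by move=> xA j /=; rewrite inE => ->.
  by move=> /(_ i); rewrite /= inE eqxx => /(_ isT).
Qed.

Lemma cylinder_measurable J : cylinder J `<=` measurable.
Proof.
by move=> _ [E [K [FE _ ->]]]; apply: bigcap_fset_measurable => i; exact: Fm.
Qed.

(** Cylinders form a pi-system on either side, and on cylinders the product
    formula is mutual independence; [pi_lambda_indep] is applied to one side at
    a time. *)
Lemma grouping_indep (J1 J2 : set I) A B : (forall i, ~ (J1 i /\ J2 i)) ->
  <<s \bigcup_(i in J1) F i >> A -> <<s \bigcup_(i in J2) F i >> B ->
  P (A `&` B) = (P A * P B)%E.
Proof.
move=> J12 /sub_cylinder sA /sub_cylinder sB.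
have gm (J : set I) C : <<s cylinder J >> C -> measurable C.
  move: C; apply: smallest_sub; first exact: sigma_algebra_measurable.
  exact: cylinder_measurable.
apply: (pi_lambda_indep (@cylinder_setI J1)) => //.
- exact: cylinder_measurable.
- exact: (gm J2).
- move=> {sA} {}A cA; rewrite setIC muleC.
  apply: (pi_lambda_indep (@cylinder_setI J2)) => //.
  + exact: cylinder_measurable.
  + exact: (@cylinder_measurable J1).
  + by move=> C cC; rewrite setIC muleC; exact: (cylinder_indep J12).
Qed.

Lemma distinct_indep (i j : I) A B : i != j -> F i A -> F j B ->
  P (A `&` B) = (P A * P B)%E.
Proof.
move=> ij FA FB; apply: (@grouping_indep [set i] [set j]).
- by move=> k /= [-> ji]; rewrite ji eqxx in ij.
- by apply: sub_sigma_algebra; exists i.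
- by apply: sub_sigma_algebra; exists j.
Qed.

End independence_theory.

(** * Fubini for independent variables *)

Section joint_law.
Context {d : measure_display} {T : measurableType d} {R : realType}.
Variable P : probability T R.
Context {d1 d2 : measure_display}.

Definition indep2 (U1 : measurableType d1) (U2 : measurableType d2)
    (X : T -> U1) (Y : T -> U2) :=
  forall A B, measurable A -> measurable B ->
    P (X @^-1` A `&` Y @^-1` B) = (P (X @^-1` A) * P (Y @^-1` B))%E.

(** Independence says that the joint law and the product of the marginal laws
    agree on rectangles; they are then the same measure, and Tonelli applies. *)
Lemma indep2_integral (U1 : measurableType d1) (U2 : measurableType d2)
    (X : {mfun T >-> U1}) (Y : {mfun T >-> U2}) (f : U1 * U2 -> \bar R) :
  indep2 X Y -> measurable_fun setT f -> (forall z, 0 <= f z)%E ->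
  (\int[P]_omega f (X omega, Y omega) =
   \int[P]_omega \int[distribution P Y]_y f (X omega, y))%E.
Proof.
move=> XY mf f0.
have mXY : measurable_fun setT (fun omega => (X omega, Y omega)).
  by apply/measurable_fun_pairP; split; exact: measurable_funP.
pose Z : {mfun T >-> (U1 * U2)%type} := HB.pack
  (fun omega => (X omega, Y omega)) (isMeasurableFun.Build _ _ _ _ _ mXY).
have Zprod A : measurable A ->
    (distribution P X \x distribution P Y)%E A = distribution P Z A.
  by apply: product_measure_unique => B C mB mC; exact: XY.
transitivity (\int[distribution P Z]_z f z)%E.
  by rewrite ge0_integral_distribution.
transitivity (\int[(distribution P X \x distribution P Y)%E]_z f z)%E.
  by apply/esym/eq_measure_integral => A mA _; exact: Zprod.
rewrite (fubini_tonelli1 f mf f0) ge0_integral_distribution//.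
- exact: measurable_fun_fubini_tonelli_F.
- by move=> x; exact: integral_ge0.
Qed.

End joint_law.

Section joint_law3.
Context {d : measure_display} {T : measurableType d} {R : realType}.
Variable P : probability T R.
Context {d1 d2 d3 : measure_display} (U1 : measurableType d1)
  (U2 : measurableType d2) (U3 : measurableType d3).
Variables (X : {mfun T >-> U1}) (Y : {mfun T >-> U2}) (Z : {mfun T >-> U3}).

(** The rectangles of the first two coordinates are a pi-system that generates
    the product sigma-algebra. *)
Lemma indep2_pair :
  (forall A B C, measurable A -> measurable B -> measurable C ->
    P (X @^-1` A `&` Y @^-1` B `&` Z @^-1` C) =
    (P (X @^-1` A `&` Y @^-1` B) * P (Z @^-1` C))%E) ->
  indep2 P (fun omega => (X omega, Y omega)) Z.
Proof.
move=> XYZ S C mS mC.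
set XY := (fun omega => _).
have mXY : measurable_fun setT XY.
  by apply/measurable_fun_pairP; split; exact: measurable_funP.
pose G : set_system T := [set XY @^-1` (A `*` B) | A in measurable & B in measurable].
have mG : G `<=` measurable.
  move=> _ [A mA] [B mB] <-; rewrite -[_ @^-1` _]setTI; apply: mXY => //.
  exact: measurableX.
apply: (@pi_lambda_indep _ _ _ P G) => //.
- move=> _ _ [A mA] [B mB] <- [A' mA'] [B' mB'] <-.
  exists (A `&` A'); first exact: measurableI.
  exists (B `&` B'); first exact: measurableI.
  by rewrite setXI preimage_setI.
- by rewrite -[_ @^-1` _]setTI; apply: measurable_funP.
- by move=> _ [A mA] [B mB] <-; exact: XYZ.
move: mS; rewrite measurable_prod_measurableType => mS.
pose H := [set S | <<s G >> (XY @^-1` S)].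
suff : <<s [set A `*` B | A in measurable & B in measurable] >> `<=` H by apply.
apply: smallest_sub.
- have := @sigma_algebra_image _ _ setT XY _ (smallest_sigma_algebra setT G).
  by rewrite /image_set_system/=; under eq_fun do rewrite setTI.
- by move=> _ [A mA] [B mB] <-; apply: sub_sigma_algebra; exists A => //; exists B.
Qed.

End joint_law3.

(** * Poisson tails and their derivatives *)

Section pointwise_derivatives.
Context {R : realType}.
Implicit Types f g : R -> R.

Lemma is_derive_add f g (x a b c : R) : is_derive x 1 f a -> is_derive x 1 g b ->
  a + b = c -> is_derive x 1 (fun y => f y + g y) c.
Proof. by move=> fa gb <-; exact: is_deriveD. Qed.

Lemma is_derive_mul f g (x a b c : R) : is_derive x 1 f a -> is_derive x 1 g b ->
  a * g x + f x * b = c -> is_derive x 1 (fun y => f y * g y) c.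
Proof.
move=> fa gb <-; apply: is_derive_eq (is_deriveM fa gb) _.
by rewrite /GRing.scale/= addrC [g x * a]mulrC.
Qed.

Lemma is_derive_chain f g (x a b c : R) :
  is_derive (g x) 1 f a -> is_derive x 1 g b ->
  b * a = c -> is_derive x 1 (fun y => f (g y)) c.
Proof.
move=> fa gb <-; apply: is_derive_eq (is_derive1_comp fa gb) _.
by rewrite mulrC.
Qed.

Lemma is_derive_const (c x : R) : is_derive x 1 (fun=> c) 0.
Proof. exact: is_derive_cst. Qed.

Lemma is_derive_pow n (x : R) :
  is_derive x 1 (fun y => y ^+ n.+1) (n.+1%:R * x ^+ n).
Proof.
have := is_deriveX n.+1 (is_derive_id x 1).
rewrite /GRing.scale/= mulr1; congr (is_derive x 1 _ _).
by apply/funext => y; rewrite fctE.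
Qed.

Lemma is_derive_linear (k x : R) : is_derive x 1 (fun y => k * y) k.
Proof.
apply: (is_derive_mul (is_derive_cst k x 1) (is_derive_id x 1)).
by rewrite mul0r add0r mulr1.
Qed.

Lemma is_derive_expR_linear (k x : R) :
  is_derive x 1 (fun y => expR (k * y)) (k * expR (k * x)).
Proof.
exact: (is_derive_chain (is_derive_expR _) (is_derive_linear k x)).
Qed.

End pointwise_derivatives.

Section poisson_tail.
Context {R : realType}.

(** For x >= 0, the probability that a Poisson variable of mean x is at least m;
    also the distribution function at x of a sum of m exponential variables of
    rate 1. *)
Definition poisson_tail (m : nat) (x : R) : R :=
  1 - expR (- x) * \sum_(r < m) x ^+ r / r`!%:R.

Lemma poisson_tail0 x : poisson_tail 0 x = 1.
Proof. by rewrite /poisson_tail big_ord0 mulr0 subr0. Qed.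

Lemma poisson_tailS m x :
  poisson_tail m.+1 x = poisson_tail m x - expR (- x) * (x ^+ m / m`!%:R).
Proof. by rewrite /poisson_tail big_ord_recr/= mulrDr opprD addrA. Qed.

Lemma poisson_tailS_0 m : poisson_tail m.+1 0 = 0.
Proof.
elim: m => [|m IH]; rewrite poisson_tailS.
  by rewrite poisson_tail0 oppr0 expR0 fact0 divr1 mulr1 subrr.
by rewrite IH expr0n/= mul0r mulr0 subrr.
Qed.

(** The density of the sum of m.+1 exponential variables: differentiating the
    defining sum telescopes. *)
Lemma is_derive_poisson_tail m (x : R) :
  is_derive x 1 (poisson_tail m.+1) (expR (- x) * (x ^+ m / m`!%:R)).
Proof.
have eN (y : R) : is_derive y 1 (fun z : R => expR (- z)) (- expR (- y)).
  apply: (is_derive_chain (is_derive_expR _) (is_deriveNid y 1)).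
  by rewrite mulN1r.
elim: m => [|m IH].
  have -> : poisson_tail 1 = fun y : R => 1 + (-1) * expR (- y).
    apply/funext => y; rewrite poisson_tailS poisson_tail0.
    by rewrite fact0 divr1 mulr1 mulN1r.
  refine (is_derive_add (is_derive_const 1 x)
    (is_derive_mul (is_derive_const (-1) x) (eN x) erefl) _).
  by rewrite expr0 fact0; field.
have -> : poisson_tail m.+2 =
    (fun y => poisson_tail m.+1 y +
      expR (- y) * ((- (m.+1`!%:R)^-1) * y ^+ m.+1)).
  by apply/funext => y; rewrite poisson_tailS; ring.
refine (is_derive_add IH (is_derive_mul (eN x)
  (is_derive_mul (is_derive_const _ x)
     (is_derive_pow m x) erefl) erefl) _).
have m0 : m.+1%:R != 0 :> R by rewrite pnatr_eq0.
have mf : m`!%:R != 0 :> R by rewrite pnatr_eq0 -lt0n fact_gt0.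
rewrite factS natrM /GRing.scale /= exprS; field.
by rewrite mf -mulrS m0.
Qed.

End poisson_tail.

(** * The exponential law *)

Section exponential_clock.
Context {R : realType}.
Local Notation mu := (@lebesgue_measure R).

Lemma integral_itv_cc_derive (f F : R -> R) (a b : R) : a <= b ->
  (forall x : R, is_derive x 1 F (f x)) -> continuous f ->
  (\int[mu]_(x in `[a, b]) (f x)%:E = (F b - F a)%:E)%E.
Proof.
rewrite le_eqVlt => /predU1P[->|ab] dF cf.
  by rewrite set_itv1 integral_set1 subrr.
have cF : continuous F.
  move=> x; apply: differentiable_continuous; apply/derivable1_diffP.
  by case: (dF x).
rewrite (continuous_FTC2 (F := F) ab).
- by rewrite EFinB.
- exact: continuous_subspaceT.
- split.
  + by move=> x _; case: (dF x).
  + by apply: cvg_at_right_filter; exact: cF.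
  + by apply: cvg_at_left_filter; exact: cF.
- by move=> x _; rewrite derive1E; exact: derive_val.
Qed.

Variable r : R.

Lemma continuous_expR_linear (k : R) : continuous (fun x => expR (k * x)).
Proof.
move=> x; apply: differentiable_continuous; apply/derivable1_diffP.
by case: (is_derive_expR_linear k x).
Qed.

(** The probability that x + Y <= v for an exponential variable Y of rate r. *)
Definition exp_cdf (v x : R) : R :=
  if x <= v then 1 - expR (- (r * (v - x))) else 0.

(** This is the layer-cake form of [exp_cdf]: x enters only through the
    indicator of x <= u, so taking the expectation over a random x will replace
    that indicator by a distribution function. *)
Lemma exp_cdf_integral (v x : R) : 0 <= x ->
  (\int[mu]_(u in `[0%R, v]) (r * expR (- (r * (v - u))) * (x <= u)%R%:R)%:E =
  (exp_cdf v x)%:E)%E.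
Proof.
move=> x0.
have -> : (\int[mu]_(u in `[0%R, v]) (r * expR (- (r * (v - u))) * (x <= u)%R%:R)%:E
   = \int[mu]_(u in `[x, v]) (r * expR (- (r * (v - u))))%:E)%E.
  rewrite [RHS]integral_mkcond [LHS]integral_mkcond; apply: eq_integral => u _.
  rewrite !patchE !mem_setE !in_itv/=.
  case: (leP x u) => xu; rewrite ?mulr1 ?mulr0/=; last by case: ifP.
  by rewrite (le_trans x0 xu).
rewrite /exp_cdf; case: leP => xv; last first.
  by rewrite set_itv_ge ?integral_set0// bnd_simp -ltNge.
have D (u : R) : is_derive u 1 (fun y => expR (- (r * v)) * expR (r * y))
    (r * expR (- (r * (v - u)))).
  refine (is_derive_mul (is_derive_const _ u) (is_derive_expR_linear r u) _).
  rewrite mul0r add0r mulrCA -expRD; congr (_ * expR _); ring.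
rewrite (integral_itv_cc_derive xv D).
  by rewrite -!expRD; congr (_ - _)%:E; rewrite ?addNr ?expR0//; congr expR; ring.
under eq_fun do rewrite mulrBr opprB expRD.
move=> u; apply: cvgM; first exact: cvg_cst.
by apply: cvgM; [exact: continuous_expR_linear|exact: cvg_cst].
Qed.

Variable nu : probability R R.
Hypothesis nuE : forall A, measurable A -> nu A = exponential_prob r A.

Lemma exponential_lt0 : nu `]-oo, 0[%classic = 0%E.
Proof.
rewrite nuE// /exponential_prob integral0_eq// => x /=; rewrite in_itv/= => x0.
by rewrite lt0_exponential_pdf.
Qed.

Lemma exponential_set1 (c : R) : nu [set c] = 0%E.
Proof. by rewrite nuE// /exponential_prob integral_set1. Qed.

Lemma exponential_itv0c (c : R) : 0 <= c ->
  nu `[0, c]%classic = (1 - expR (- (r * c)))%:E.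
Proof.
rewrite le_eqVlt => /predU1P[<-|c0].
  by rewrite set_itv1 exponential_set1 mulr0 oppr0 expR0 subrr.
by rewrite nuE// exponential_prob_itv0c// mulNr EFinB.
Qed.

Lemma exponential_le (c : R) : nu `]-oo, c]%classic = (exp_cdf c 0)%:E.
Proof.
rewrite /exp_cdf subr0; case: leP => c0.
  have -> : `]-oo, c]%classic = `]-oo, 0[%classic `|` `[0, c]%classic :> set R.
    apply/seteqP; split=> x /=; rewrite !in_itv/=.
      by move=> xc; case: (ltP x 0) => ?; [left|right; rewrite xc].
    by case=> [/ltW xl|/andP[_]//]; exact: le_trans c0.
  rewrite measureU//=.
    by rewrite exponential_lt0 add0e exponential_itv0c.
  apply/seteqP; split=> x //=; rewrite !in_itv/= => -[h /andP[h1 _]].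
  by have := lt_le_trans h h1; rewrite ltxx.
apply/eqP; rewrite eq_le measure_ge0 andbT.
have /eqP := exponential_lt0; rewrite eq_le => /andP[+ _]; apply: le_trans.
apply: le_measure; rewrite ?inE// => x /=; rewrite !in_itv/= => h.
exact: le_lt_trans h c0.
Qed.

Lemma exponential_lt (c : R) : nu `]-oo, c[%classic = (exp_cdf c 0)%:E.
Proof.
rewrite -exponential_le.
have -> : `]-oo, c]%classic = `]-oo, c[%classic `|` [set c] :> set R.
  apply/seteqP; split=> x /=; rewrite !in_itv/= le_eqVlt.
    by case/orP => [/eqP ->|]; [right|left].
  by case=> [->|->]; rewrite ?eqxx ?orbT.
rewrite measureU//=; first by rewrite exponential_set1 adde0.
by apply/seteqP; split=> x //=; rewrite in_itv/= => -[xc xE]; rewrite xE ltxx in xc.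
Qed.

Lemma exponential_gt (c : R) : 0 <= c ->
  nu `]c, +oo[%classic = (expR (- (r * c)))%:E.
Proof.
move=> c0; rewrite -setCitvl probability_setC// exponential_le /exp_cdf c0 subr0.
by rewrite -EFinB; congr EFin; ring.
Qed.

Lemma exponential_ge (c : R) : 0 <= c ->
  nu `[c, +oo[%classic = (expR (- (r * c)))%:E.
Proof.
move=> c0; rewrite -setCitvl probability_setC// exponential_lt /exp_cdf c0 subr0.
by rewrite -EFinB; congr EFin; ring.
Qed.

End exponential_clock.

(** * Adding an independent exponential variable *)

Section convolution.
Context {d : measure_display} {T : measurableType d} {R : realType}.
Variable P : probability T R.
Local Notation leb := (@lebesgue_measure R).
Variables (r : R) (X : {mfun T >-> R}).
Hypothesis r0 : 0 < r.

Lemma measurable_exp_cdf v : measurable_fun setT (exp_cdf r v).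
Proof.
apply: measurable_fun_if => //; first exact: measurable_fun_ler.
by apply: measurable_funB => //; apply: measurableT_comp => //;
  apply: measurableT_comp => //; apply: measurable_funM => //; apply: measurable_funB.
Qed.

Lemma exp_cdf_ge0 v x : 0 <= exp_cdf r v x.
Proof.
rewrite /exp_cdf; case: (leP x v) => // xv.
by rewrite subr_ge0 -[leRHS]expR0 ler_expR oppr_le0 mulr_ge0 ?subr_ge0// ltW.
Qed.

(** Tonelli applied to [exp_cdf_integral]: only the distribution function of X
    matters. *)
Lemma integral_exp_cdf v : {ae P, forall omega, 0 <= X omega} ->
  (\int[P]_omega (exp_cdf r v (X omega))%:E =
   \int[leb]_(u in `[0%R, v])
      ((r * expR (- (r * (v - u))))%:E * P [set omega | X omega <= u]%R))%E.
Proof.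
move=> X0.
(* The kernel of the integral, extended by 0 to the whole line. *)
pose k u := (u \in `[0, v])%:R * (r * expR (- (r * (v - u)))) : R.
have k0 u : 0 <= k u by rewrite !mulr_ge0// ?expR_ge0// ltW.
have mk : measurable_fun setT k.
  apply: measurable_funM.
    have -> : (fun u => (u \in `[0, v])%:R) = \1_`[0, v] :> (R -> R).
      by apply/funext => u; rewrite indicE mem_setE.
    exact: measurable_indic.
  apply: measurable_funM => //; apply: measurableT_comp => //.
  by apply: measurableT_comp => //; apply: measurable_funM => //; apply: measurable_funB.
pose f (z : T * R) : \bar R := (k z.2 * (X z.1 <= z.2)%R%:R)%:E.
have mf : measurable_fun setT f.
  apply/measurable_EFinP; apply: measurable_funM.
    by apply: measurableT_comp => //.
  have m : measurable_fun setT (fun z : T * R => X z.1 <= z.2).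
    apply: measurable_fun_ler => //; exact: measurableT_comp.
  have -> : (fun z : T * R => (X z.1 <= z.2)%R%:R) =
     \1_((fun z : T * R => X z.1 <= z.2) @^-1` [set true]) :> (T * R -> R).
    apply/funext => z; rewrite indicE; congr (nat_of_bool _)%:R.
    by apply/idP/idP; rewrite inE.
  by apply: measurable_indic; rewrite -[_ @^-1` _]setTI; apply: m.
have f0 z : (0 <= f z)%E by rewrite lee_fin mulr_ge0.
have := fubini_tonelli (m1 := P) (m2 := leb) f mf f0; rewrite /fubini_F /fubini_G.
move=> FT.
transitivity (\int[P]_x \int[leb]_y f (x, y))%E.
  apply: ae_eq_integral => //.
  - by apply/measurable_EFinP; apply: measurableT_comp => //; exact: measurable_exp_cdf.
  - exact: (measurable_fun_fubini_tonelli_F (m2 := leb) f mf f0).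
  - apply: filterS X0 => x x0 _.
    rewrite -(exp_cdf_integral r v x0) [LHS]integral_mkcond.
    apply: eq_integral => u _; rewrite patchE mem_setE /f /k/=.
    by case: ifP => _; rewrite ?mul1r ?mul0r.
rewrite FT [RHS]integral_mkcond; apply: eq_integral => u _.
have mXu : measurable [set omega | X omega <= u].
  have -> : [set omega | X omega <= u] = X @^-1` `]-oo, u]%classic.
    by apply/seteqP; split => x /=; rewrite in_itv.
  by rewrite -[_ @^-1` _]setTI; apply: measurable_funP.
transitivity ((k u)%:E * P [set omega | X omega <= u]%R)%E.
  have -> : P [set omega | X omega <= u] =
      (\int[P]_omega (\1_[set omega | X omega <= u] omega)%:E)%E.
    by rewrite integral_indic// setIT.
  rewrite -ge0_integralZl//.
  - apply: eq_integral => x _; rewrite /f/= -EFinM indicE; congr (_ * (nat_of_bool _)%:R)%:E.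
    by apply/idP/idP; rewrite inE.
  - by apply/measurable_EFinP; exact: measurable_indic.
  - by rewrite lee_fin.
by rewrite patchE mem_setE /k; case: ifP => _; rewrite ?mul1r ?mul0r ?mul0e.
Qed.

(** After factoring exp(- r v), the integrand of [integral_exp_cdf] is the
    derivative of H. *)
Lemma integral_exp_cdf_primitive (G H : R -> R) v :
  {ae P, forall omega, 0 <= X omega} ->
  (forall u, 0 <= u -> P [set omega | X omega <= u] = (G u)%:E) ->
  (forall u : R, is_derive u 1 H (r * expR (r * u) * G u)) -> continuous G ->
  H 0 = 0 -> 0 <= v ->
  (\int[P]_omega (exp_cdf r v (X omega))%:E = (expR (- (r * v)) * H v)%:E)%E.
Proof.
move=> X0 XG dH cG H0 v0; rewrite integral_exp_cdf//.
have D (u : R) : is_derive u 1 (fun u => expR (- (r * v)) * H u)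
    (r * expR (- (r * (v - u))) * G u).
  refine (is_derive_mul (is_derive_const _ u) (dH u) _).
  have -> : expR (- (r * (v - u))) = expR (- (r * v)) * expR (r * u).
    by rewrite -expRD; congr expR; ring.
  by ring.
transitivity (\int[leb]_(u in `[0%R, v]) (r * expR (- (r * (v - u))) * G u)%:E)%E.
  apply: eq_integral => u; rewrite mem_setE in_itv/= => /andP[u0 _].
  by rewrite XG// -EFinM.
rewrite (integral_itv_cc_derive v0 D) ?H0 ?mulr0 ?subr0//.
(* The exponential of the affine function splits into a constant and a
   function of r * u. *)
have cE : continuous (fun u => expR (- (r * (v - u)))).
  have -> : (fun u => expR (- (r * (v - u)))) =
      fun u => expR (- (r * v)) * expR (r * u).
    by apply/funext => y; rewrite -expRD; congr expR; ring.
  by move=> u; apply: cvgM; [exact: cvg_cst|exact: continuous_expR_linear].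
move=> u; apply: cvgM; last exact: cG.
by apply: cvgM; [exact: cvg_cst|exact: cE].
Qed.

Variable Y : {mfun T >-> R}.
Hypothesis XY : indep2 P X Y.
Hypothesis YE : has_law P Y (exponential_prob r).

(** The strict and the large inequality are treated together, since the
    exponential law has no atom. *)
Lemma convolution_exponential (b : bool) v :
  P [set omega | X omega + Y omega < v ?<= if b] =
  (\int[P]_omega (exp_cdf r v (X omega))%:E)%E.
Proof.
have mA : measurable [set z : R * R | z.1 + z.2 < v ?<= if b].
  have m : measurable_fun setT (fun z : R * R => z.1 + z.2 < v ?<= if b).
    by case: b => /=; [apply: measurable_fun_ler|apply: measurable_fun_ltr] => //;
      apply: measurable_funD.
  have := m measurableT [set true]; rewrite setTI; apply; exact: I.
set A := [set z | _] in mA.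
have mXY : measurable_fun setT (fun omega => (X omega, Y omega)).
  exact: measurable_fun_pair.
have -> : [set omega | X omega + Y omega < v ?<= if b] =
   (fun omega => (X omega, Y omega)) @^-1` A by [].
rewrite -[X in P X]setIT -(integral_indic P measurableT); last first.
  by rewrite -[_ @^-1` _]setTI; apply: mXY.
transitivity (\int[P]_omega (\1_A (X omega, Y omega))%:E)%E; first by [].
rewrite (indep2_integral XY (f := fun z => (\1_A z)%:E)) => //; last first.
  by apply/measurable_EFinP; exact: measurable_indic.
apply: eq_integral => omega _; set x := X omega.
transitivity (\int[distribution P Y]_y (\1_([set y | x + y < v ?<= if b]) y)%:E)%E.
  by apply: eq_integral => y _; rewrite !indicE.
have -> : [set y | x + y < v ?<= if b] =
   (if b then `]-oo, v - x]%classic else `]-oo, v - x[%classic).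
  by apply/seteqP; split => y /=; case: (b) => /=; rewrite in_itv/= ?lerBrDl ?ltrBrDl.
rewrite integral_indic ?setIT//; last by case: (b).
transitivity ((exp_cdf r (v - x) 0)%:E).
  case: (b); first exact: (@exponential_le _ _ (distribution P Y) YE).
  exact: (@exponential_lt _ _ (distribution P Y) YE).
by rewrite /exp_cdf subr_ge0 subr0.
Qed.

End convolution.

(** * Sums of independent exponential variables *)

Section sub_sigma_algebra.
Context {d : measure_display} {T : measurableType d} {R : realType}.

Lemma measurable_fun_generated (G : set_system T) d' (U : measurableType d')
    (X : T -> U) : g_sigma_algebra_preimage X `<=` <<s G >> ->
  measurable_fun [set: g_sigma_algebraType G] (X : g_sigma_algebraType G -> U).
Proof. by move=> XG _ A mA; apply: XG; exists A. Qed.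

Lemma sigma_algebra_preimage_rv d' (U : measurableType d') (X : {mfun T >-> U}) :
  sigma_algebra setT (g_sigma_algebra_preimage X).
Proof. exact: (@sigma_algebra_measurable _ (g_sigma_algebra_preimageType X)). Qed.

Lemma preimage_rv_measurable d' (U : measurableType d') (X : {mfun T >-> U}) :
  g_sigma_algebra_preimage X `<=` measurable.
Proof. by move=> _ [A mA <-]; exact: measurable_funP. Qed.

End sub_sigma_algebra.

Section exponential_sums.
Context {d : measure_display} {T : measurableType d} {R : realType}.
Variable P : probability T R.
Variables (I : choiceType) (xi : R) (W : I -> {mfun T >-> R}).
Hypothesis xi0 : 0 < xi.
Hypothesis WE : iid_exponential P xi (fun i => W i : T -> R).

Lemma exponential_ge0_ae (Y : {mfun T >-> R}) : has_law P Y (exponential_prob xi) ->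
  {ae P, forall omega, 0 <= Y omega}.
Proof.
move=> YE; exists (Y @^-1` `]-oo, 0[%classic); split.
- by rewrite -[_ @^-1` _]setTI; exact: measurable_funP.
- exact: (@exponential_lt0 _ _ (distribution P Y) YE).
- by move=> omega /= h; rewrite in_itv/= ltNge; exact/negP.
Qed.

Lemma sum_indep (s : seq I) p : p \notin s ->
  indep2 P (\sum_(q <- s) W q : {mfun T >-> R}) (W p).
Proof.
move=> ps A B mA mB.
have [Wi _] := WE.
pose F i := g_sigma_algebra_preimage (W i).
have Fs i : sigma_algebra setT (F i) by exact: sigma_algebra_preimage_rv.
have Fm i : F i `<=` measurable by exact: preimage_rv_measurable.
apply: (grouping_indep Fs Fm Wi (J1 := [set q | q \in s]) (J2 := [set p])) => //.
- by move=> i /= [is_ ip]; rewrite ip (negbTE ps) in is_.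
- set G := \bigcup_(i in _) _.
  have : measurable_fun [set: g_sigma_algebraType G]
     (fun omega => \sum_(q <- s) if q \in s then W q omega else 0).
    apply: measurable_sum => q; have [qs|qs] := boolP (q \in s).
      apply: measurable_fun_generated; apply: (subset_trans _ (@sub_sigma_algebra _ setT G)).
      exact: (bigcup_sup (i := q)).
    exact: measurable_cst.
  move=> /(_ measurableT A mA); rewrite setTI.
  congr (measurable _); congr (_ @^-1` A); apply/funext => omega.
  by rewrite mfun_sum; apply: eq_big_seq => q qs; rewrite qs.
- apply: sub_sigma_algebra; exists p => //; exists B => //.
  by rewrite setTI.
Qed.

Lemma sum_ge0_ae (s : seq I) : {ae P, forall omega, 0 <= \sum_(q <- s) W q omega}.
Proof.
have [_ Wl] := WE.
elim: s => [|p s IH]; first by apply: aeW => omega; rewrite big_nil.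
apply: filterS2 IH (exponential_ge0_ae (Wl p)) => omega h1 h2.
by rewrite big_cons addr_ge0.
Qed.

Lemma continuous_poisson_tail m (k : R) : continuous (fun u => poisson_tail m (k * u)).
Proof.
move=> u; case: m => [|m].
  by under eq_fun do rewrite poisson_tail0; exact: cvg_cst.
apply: differentiable_continuous; apply/derivable1_diffP.
by have [] := is_derive_chain (is_derive_poisson_tail m (k * u)) (is_derive_linear k u) erefl.
Qed.

(** This is the primitive by which adding one exponential variable raises the
    index of the Poisson tail by one. *)
Lemma is_derive_erlang m (u : R) :
  is_derive u 1 (fun u => expR (xi * u) * poisson_tail m.+1 (xi * u))
    (xi * expR (xi * u) * poisson_tail m (xi * u)).
Proof.
refine (is_derive_mul (is_derive_expR_linear xi u)
  (is_derive_chain (is_derive_poisson_tail m (xi * u)) (is_derive_linear xi u) erefl) _).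
rewrite poisson_tailS; set e := expR (- _).
have -> : expR (xi * u) = e^-1 by rewrite /e expRN invrK.
have e0 : e != 0 by rewrite gt_eqF// expR_gt0.
have mf : m`!%:R != 0 :> R by rewrite pnatr_eq0 -lt0n fact_gt0.
by field; rewrite e0 mf.
Qed.

(** Both forms are needed: the large inequality feeds the induction, the strict
    one is what staying in [0, V[ asks for. At v = 0 the strict form fails for
    the empty sum. *)
Lemma sum_exponential (s : seq I) : uniq s ->
  (forall v, 0 <= v -> P [set omega | \sum_(q <- s) W q omega <= v] =
     (poisson_tail (size s) (xi * v))%:E) /\
  (forall v, 0 < v -> P [set omega | \sum_(q <- s) W q omega < v] =
     (poisson_tail (size s) (xi * v))%:E).
Proof.
have [_ Wl] := WE.
elim: s => [_|p s IH /= /andP[ps us]].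
  split=> v v0; rewrite poisson_tail0 -(probability_setT P); congr (P _);
  by apply/seteqP; split=> // x _ /=; rewrite big_nil.
have {}IH := (IH us).1.
pose X : {mfun T >-> R} := \sum_(q <- s) W q.
have XE omega : X omega = \sum_(q <- s) W q omega by rewrite mfun_sum.
have key v : 0 <= v -> (\int[P]_omega (exp_cdf xi v (X omega))%:E)%E =
    (poisson_tail (size s).+1 (xi * v))%:E.
  move=> v0; rewrite (integral_exp_cdf_primitive
     (G := fun u => poisson_tail (size s) (xi * u)) xi0 _ _ (is_derive_erlang (size s))) //.
  - by rewrite mulrA -expRD addNr expR0 mul1r.
  - by apply: filterS (sum_ge0_ae s) => omega; rewrite XE.
  - move=> u u0; rewrite -IH//; congr (P _); apply/seteqP.
    by split=> omega /=; rewrite XE.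
  - exact: continuous_poisson_tail.
  - by rewrite !mulr0 poisson_tailS_0 mulr0.
split=> v v0.
  rewrite -key// -(convolution_exponential (sum_indep ps) (Wl p) true)//.
  by congr (P _); apply/seteqP; split=> omega /=; rewrite big_cons XE addrC.
rewrite -key ?ltW// -(convolution_exponential (sum_indep ps) (Wl p) false)//.
by congr (P _); apply/seteqP; split=> omega /=; rewrite big_cons XE addrC.
Qed.

End exponential_sums.

(** * Almost sure comparison and increasing sequences *)

Section almost_sure.
Context {d : measure_display} {T : measurableType d} {R : realType}.
Variable P : probability T R.

Lemma le_measure_ae (A B : set T) : measurable A -> measurable B ->
  {ae P, forall omega, A omega -> B omega} -> (P A <= P B)%E.
Proof.
move=> mA mB [N [mN N0 AB]].
have -> : P B = (P B + P N)%E by rewrite N0 adde0.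
apply: le_trans (measureU2 _ mB mN); apply: le_measure; rewrite ?inE//.
  exact: measurableU.
move=> omega Ao; have [No|No] := pselect (N omega); [by right|left].
by apply: contrapT => nB; apply: No; apply: AB => /= h; exact: nB (h Ao).
Qed.

Lemma eq_measure_ae (A B : set T) : measurable A -> measurable B ->
  {ae P, forall omega, A omega <-> B omega} -> P A = P B.
Proof.
move=> mA mB AB; apply/eqP; rewrite eq_le; apply/andP; split.
  by apply: le_measure_ae => //; apply: filterS AB => omega [].
by apply: le_measure_ae => //; apply: filterS AB => omega [].
Qed.

End almost_sure.

Section strict_paths.
Context {R : realType} (f : nat -> R).
Hypothesis fS : forall k, f k < f k.+1.

Lemma strict_path_lt i j : (i < j)%N -> f i < f j.
Proof.
elim: j => // j IH; rewrite ltnS leq_eqVlt => /predU1P[->//|/IH h].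
exact: lt_trans h (fS j).
Qed.

Lemma strict_path_le i j : (i <= j)%N -> f i <= f j.
Proof. by rewrite leq_eqVlt => /predU1P[->//|/strict_path_lt/ltW]. Qed.

End strict_paths.

(** * The law of the k-th point of a Poisson process *)

Section poisson_points_law.
Context {d : measure_display} {T : measurableType d} {R : realType}.
Variable P : probability T R.
Variables (lambda : R) (t : nat -> {mfun T >-> R}).
Hypothesis lambda0 : 0 < lambda.
Hypothesis tP : poisson_points P lambda (fun k => t k : T -> R).

(** There are countably many finite sets of indices, and the set of indices of
    the points in ]s, u] is one of them as soon as the count is finite. *)
Lemma measurable_count_points (s u : R) (j : nat) :
  measurable [set omega | count_points (fun k => t k : T -> R) s u omega = j%:R%:E].
Proof.
(* The random set of the indices that are counted. *)
pose K omega := [set k | s < t k omega <= u].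
have -> : [set omega | count_points (fun k => t k : T -> R) s u omega = j%:R%:E] =
  \bigcup_(F : {fset nat}) (if #|` F| == j then [set omega | K omega = [set` F]] else set0).
  apply/seteqP; split=> omega /=; rewrite /count_points /counting -/(K omega).
    case: asboolP => // fK [] /eqP; rewrite eqr_nat => Kj.
    by exists (fset_set (K omega)) => //; rewrite Kj/= fset_setK.
  move=> [F _]; case: eqP => // Fj /= KF; rewrite asboolT; last first.
    by rewrite KF; exact: finite_fset.
  by rewrite KF set_fsetK Fj.
apply: countable_bigcupT_measurable; first exact: countableP.
move=> F; case: ifP => // _.
have -> : [set omega | K omega = [set` F]] =
  \bigcap_k (if k \in F then t k @^-1` `]s, u]%classic else t k @^-1` (~` `]s, u]%classic)).
  apply/seteqP; split=> omega /=.
    move=> KF k _; have : K omega k <-> k \in F by rewrite KF.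
    rewrite /K/=; case: ifP => kF /=; rewrite in_itv/=; first by case=> _; exact.
    by case=> h _ /h.
  move=> h; apply/seteqP; split=> k /=.
    by have := h k I; case: ifP => //= kF; rewrite in_itv/=.
  by move=> kF; have := h k I; rewrite kF/= in_itv.
apply: bigcapT_measurable => k; case: ifP => _; rewrite -[_ @^-1` _]setTI;
  apply: measurable_funP => //; exact: measurableC.
Qed.

(** On an increasing path the indices of the points in ]0, u] form an initial
    segment, which misses k iff it has at most k elements. *)
Lemma count_pointsE (u : R) (k : nat) omega : 0 < t 0%N omega ->
  (forall i, t i omega < t i.+1 omega) ->
  u < t k omega <->
  exists2 j, (j < k.+1)%N & count_points (fun k => t k : T -> R) 0 u omega = j%:R%:E.
Proof.
move=> t0 tS; rewrite /count_points /counting.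
set K := [set i | _]; have le_t := @strict_path_le _ (fun i => t i omega) tS.
split=> [ut|[j jk]].
  have KI : K `<=` `I_k.
    move=> i /= /andP[_ iu]; rewrite ltnNge; apply/negP => /le_t ki.
    by have := le_lt_trans (le_trans ki iu) ut; rewrite ltxx.
  have fK : finite_set K by exact: sub_finite_set KI (finite_II k).
  rewrite asboolT//; exists #|` fset_set K| => //.
  by rewrite ltnS; apply: geq_card_fset_set; exact: subset_card_le.
case: asboolP => // fK [] /eqP; rewrite eqr_nat => /eqP Kj.
rewrite ltNge; apply/negP => tu.
have KI : `I_k.+1 `<=` K.
  move=> i /=; rewrite ltnS => /le_t ik; apply/andP; split; last exact: le_trans tu.
  exact: lt_le_trans t0 (le_t 0%N i _).
have : (k.+1 <= #|` fset_set K|)%N.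
  by apply: leq_card_fset_set => //; exact: subset_card_le.
by rewrite Kj leqNgt jk.
Qed.

Lemma poisson_points_cdf (k : nat) (u : R) : 0 <= u ->
  P [set omega | t k omega <= u] = (poisson_tail k.+1 (lambda * u))%:E.
Proof.
have [tS tpmf _] := tP.
have mt (B : set R) : measurable B -> measurable (t k @^-1` B).
  by move=> mB; rewrite -[_ @^-1` _]setTI; exact: measurable_funP.
have mtk : measurable [set omega | t k omega <= u].
  have -> : [set omega | t k omega <= u] = t k @^-1` `]-oo, u]%classic.
    by apply/seteqP; split => x /=; rewrite in_itv.
  exact: mt.
rewrite le_eqVlt => /predU1P[u0|u0].
  rewrite -u0 mulr0 poisson_tailS_0 -[RHS](measure0 P); apply: eq_measure_ae.
  - by rewrite u0.
  - exact: measurable0.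
  - apply: filterS tS => omega [t0 tS]; split=> //= tk0.
    have := strict_path_le tS (leq0n k) => /= h.
    by have := lt_le_trans t0 (le_trans h tk0); rewrite ltxx.
pose C j := [set omega | count_points (fun k => t k : T -> R) 0 u omega = j%:R%:E].
have mC j : measurable (C j) by exact: measurable_count_points.
have PC : P (~` [set omega | t k omega <= u]) = (\sum_(j < k.+1) P (C j))%E.
  transitivity (P (\big[setU/set0]_(j < k.+1) C j)).
    apply: eq_measure_ae.
    - exact: measurableC.
    - exact: bigsetU_measurable.
    - apply: filterS tS => omega [t0 tS].
      have -> : (~` [set omega | t k omega <= u]) omega <-> u < t k omega.
        by rewrite /= ltNge; split=> /negP.
      rewrite (count_pointsE u k t0 tS) -bigcup_mkord.
      by split=> -[j jk Cj]; exists j.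
  rewrite measure_bigsetU//; apply/trivIsetP => i j _ _ /eqP ij.
  apply/seteqP; split=> // omega [Ci Cj]; apply: ij.
  have /eqP := etrans (esym Ci) Cj.
  by rewrite eqe eqr_nat => /eqP.
have -> : P [set omega | t k omega <= u] =
   (1 - P (~` [set omega | t k omega <= u]%R))%E.
  by rewrite -probability_setC ?setCK//; exact: measurableC.
rewrite PC; under eq_bigr do rewrite tpmf// subr0.
rewrite sumEFin -EFinB; congr EFin; congr (_ - _).
rewrite mulr_sumr; apply: eq_bigr => j _.
by rewrite /poisson_pmf mulr_gt0// mulrC.
Qed.

End poisson_points_law.

(** * Renewal processes with exponential gaps *)

Lemma ereal_le_geometric_eq0 (R : realType) (x : \bar R) (c : R) :
  0 <= c -> c < 1 -> (0 <= x)%E -> (forall k, (x <= (c ^+ k)%:E)%E) -> x = 0%E.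
Proof.
move=> c0 c1 x0 xc.
have cvg0 : (fun k => (c ^+ k)%:E) @ \oo --> 0%E.
  apply/fine_cvgP; split; first by near=> k.
  by apply: cvg_expr; rewrite ger0_norm.
apply/eqP; rewrite eq_le x0 andbT -(cvg_lim _ cvg0)//.
apply: lime_ge; last by near=> k; exact: xc.
by apply/cvg_ex; exists 0%E.
Unshelve. all: by end_near. Qed.

Section measurable_comparisons.
Context {R : realType} {d : measure_display} {U : measurableType d}.
Variables f g : U -> R.
Hypothesis mf : measurable_fun setT f.
Hypothesis mg : measurable_fun setT g.

Lemma measurable_set_lt : measurable [set z | f z < g z].
Proof.
have m := measurable_fun_ltr mf mg.
by have := m measurableT [set true] I; rewrite setTI.
Qed.

Lemma measurable_set_le : measurable [set z | f z <= g z].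
Proof.
have m := measurable_fun_ler mf mg.
by have := m measurableT [set true] I; rewrite setTI.
Qed.

End measurable_comparisons.

Definition hits {R : realType} {S : Type} (Y : S -> R) (tau : nat -> S -> R)
    (theta : R) : set S :=
  [set omega | exists k, Y omega <= tau k omega <= theta].

Lemma measurable_hits (R : realType) d (S : measurableType d) (Y : S -> R)
    (tau : nat -> S -> R) theta :
  measurable_fun setT Y -> (forall k, measurable_fun setT (tau k)) ->
  measurable (hits Y tau theta).
Proof.
move=> mY mtau.
have -> : hits Y tau theta = \bigcup_k ([set omega | Y omega <= tau k omega] `&`
     [set omega | tau k omega <= theta]).
  apply/seteqP; split=> omega; first by case=> k /andP[]; exists k.
  by case=> k _ [/= h1 h2]; exists k; rewrite h1.
by apply: bigcupT_measurable => k; apply: measurableI; exact: measurable_set_le.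
Qed.

Section renewal.
Context {d : measure_display} {T : measurableType d} {R : realType}.
Variable P : probability T R.
Variables (mu : R) (tau : nat -> {mfun T >-> R}).
Hypothesis mu0 : 0 < mu.
Hypothesis tau0 : forall omega, tau 0%N omega = 0.
Hypothesis tau_lt : {ae P, forall omega, forall k, tau k omega < tau k.+1 omega}.
Let D k : {mfun T >-> R} := tau k.+1 - tau k.
Hypothesis DE : iid_exponential P mu (fun k => D k : T -> R).

(** If tau stays below N then all gaps are at most N, which has probability
    c ^ k for the first k gaps, where c < 1. *)
Lemma renewal_unbounded_nat (N : nat) :
  {ae P, forall omega, exists k, N%:R <= tau k omega}.
Proof.
have [Di Dl] := DE.
pose B := \bigcap_k [set omega | tau k omega < (cst N%:R : {mfun T >-> R}) omega].
have mB : measurable B.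
  by apply: bigcapT_measurable => k; exact: measurable_set_lt.
pose c : R := 1 - expR (- (mu * N%:R)).
have c0 : 0 <= c by rewrite subr_ge0 -[leRHS]expR0 ler_expR oppr_le0 mulr_ge0// ltW.
have c1 : c < 1 by rewrite ltrBlDr ltrDl expR_gt0.
have Bc k : (P B <= (c ^+ k)%:E)%E.
  pose E (i : nat) := D i @^-1` `]-oo, N%:R]%classic.
  have mE i : measurable (E i).
    by rewrite /E -[_ @^-1` _]setTI; exact: measurable_funP.
  have := Di [fset i in iota 0 k]%fset E.
  have -> : (\prod_(i <- [fset i in iota 0 k]%fset) P (E i) = (c ^+ k)%:E)%E.
    rewrite (eq_bigr (fun=> c%:E)); last first.
      move=> i _; rewrite /E.
      transitivity (distribution P (D i) `]-oo, N%:R]%classic); first by [].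
      by rewrite (@exponential_le _ _ (distribution P (D i)) (Dl i)) /exp_cdf ler0n subr0.
    rewrite prodEFin; congr EFin; rewrite big_const_seq iter_mulr mulr1 count_predT.
    congr (_ ^+ _); rewrite card_fseq undup_id ?size_iota//; exact: iota_uniq.
  move=> <-; last by move=> i _; exists `]-oo, N%:R]%classic => //; rewrite setTI.
  apply: le_measure_ae => //.
    by apply: fin_bigcap_measurable => //; exact: finite_fset.
  apply: filterS tau_lt => omega tS Bo i _; rewrite /E/= in_itv/=.
  have ti : 0 <= tau i omega by rewrite -(tau0 omega); exact: (strict_path_le tS (leq0n i)).
  rewrite lerBlDr; apply: (le_trans (ltW (Bo i.+1 I))).
  by rewrite lerDl.
exists B; split => //.
- exact: (ereal_le_geometric_eq0 c0 c1).
- move=> omega /= h k _ /=; rewrite ltNge; apply/negP => hk; apply: h.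
  by exists k.
Qed.

Lemma renewal_unbounded :
  {ae P, forall omega, forall x : R, exists k, x <= tau k omega}.
Proof.
have : {ae P, forall omega, forall N : nat, exists k, N%:R <= tau k omega}.
  by apply/ae_foralln => N; exact: renewal_unbounded_nat.
apply: filterS => omega h x; have [k hk] := h (Num.truncn x).+1.
by exists k; apply: le_trans hk; exact/ltW/truncnS_gt.
Qed.

Variables (Y : {mfun T >-> R}).
Hypothesis Y0 : {ae P, forall omega, 0 < Y omega}.
Hypothesis tauYD : forall j, indep2 P (fun omega => (tau j omega, Y omega)) (D j).

(** The probability that a fresh exponential clock started at y is still running
    at time theta. *)
Let discount theta (y : R) : R := (y <= theta)%R%:R * expR (- (mu * (theta - y))).

Let measurable_discount theta : measurable_fun setT (discount theta).
Proof.
apply: measurable_funM.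
  have -> : (fun y => (y <= theta)%R%:R) = \1_`]-oo, theta] :> (R -> R).
    by apply/funext => u; rewrite indicE mem_setE in_itv.
  exact: measurable_indic.
by do 2 (apply: measurableT_comp => //); apply: measurable_funM => //; apply: measurable_funB.
Qed.

Let discount_ge0 theta y : 0 <= discount theta y.
Proof. by rewrite mulr_ge0// expR_ge0. Qed.

Let Dge j (c : R) : 0 <= c -> distribution P (D j) `[c, +oo[%classic = (expR (- (mu * c)))%:E.
Proof. exact: (@exponential_ge _ _ (distribution P (D j)) (DE.2 j)). Qed.

Let Dgt j (c : R) : 0 <= c -> distribution P (D j) `]c, +oo[%classic = (expR (- (mu * c)))%:E.
Proof. exact: (@exponential_gt _ _ (distribution P (D j)) (DE.2 j)). Qed.

(** Memorylessness. Integrating out the gap after tau_j, both sides become the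
    expectation of exp(- mu (theta - tau_j)) on {tau_j < Y <= theta}: on the
    left, that gap must exceed theta - tau_j; on the right it must reach
    Y - tau_j, which costs exp(- mu (Y - tau_j)), and the weight supplies the
    remaining exp(- mu (theta - Y)). *)
Lemma straddle_weight (j : nat) (theta : R) :
  P [set omega | tau j omega < Y omega <= theta /\ theta < tau j.+1 omega] =
  (\int[P]_(omega in [set omega | tau j omega < Y omega <= tau j.+1 omega]%R)
     (discount theta (Y omega))%:E)%E.
Proof.
pose Z : {mfun T >-> (R * R)%type} := HB.pack (fun omega => (tau j omega, Y omega))
  (isMeasurableFun.Build _ _ _ _ _
    (measurable_fun_pair (measurable_funP (tau j)) (measurable_funP Y))).
(* z stands for ((tau_j, Y), gap), so that z.1.1 + z.2 is tau_(j+1). *)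
pose A1 := [set z : (R * R) * R | z.1.1 < z.1.2 /\ z.1.2 <= theta /\ theta < z.1.1 + z.2].
pose A2 := [set z : (R * R) * R | z.1.1 < z.1.2 /\ z.1.2 <= z.1.1 + z.2].
have m11 : measurable_fun setT (fun z : (R * R) * R => z.1.1).
  exact: (measurableT_comp measurable_fst measurable_fst).
have m12 : measurable_fun setT (fun z : (R * R) * R => z.1.2).
  exact: (measurableT_comp measurable_snd measurable_fst).
have m2 : measurable_fun setT (fun z : (R * R) * R => z.2) by exact: measurable_snd.
have mA1 : measurable A1.
  apply: measurableI; first exact: measurable_set_lt.
  apply: measurableI; first exact: measurable_set_le.
  by apply: measurable_set_lt => //; exact: measurable_funD.
have mA2 : measurable A2.
  apply: measurableI; first exact: measurable_set_lt.
  by apply: measurable_set_le => //; exact: measurable_funD.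
have mZD (A : set ((R * R) * R)) : measurable A ->
    measurable [set omega | A (Z omega, D j omega)].
  move=> mA; have m : measurable_fun setT (fun omega => (Z omega, D j omega)).
    exact: measurable_fun_pair.
  by have := m measurableT A mA; rewrite setTI.
have DE' omega : tau j omega + D j omega = tau j.+1 omega.
  by rewrite /D/= addrC subrK.
have -> : [set omega | tau j omega < Y omega <= theta /\ theta < tau j.+1 omega] =
    [set omega | A1 (Z omega, D j omega)].
  apply/seteqP; split=> omega; rewrite /A1/= DE'.
    by case=> /andP[].
  by case=> -> [->].
have -> : [set omega | tau j omega < Y omega <= tau j.+1 omega] =
    [set omega | A2 (Z omega, D j omega)].
  apply/seteqP; split=> omega; rewrite /A2/= DE'; first by move=> /andP[].
  by case=> -> ->.
transitivity (\int[P]_omega (\1_A1 (Z omega, D j omega))%:E)%E.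
  by rewrite -[X in P X]setIT -(integral_indic P measurableT)//; exact: mZD.
transitivity (\int[P]_omega
    ((discount theta (Z omega).2 * \1_A2 (Z omega, D j omega))%:E))%E; last first.
  rewrite [RHS]integral_mkcond; apply: eq_integral => omega _.
  rewrite patchE indicE.
  have -> : (omega \in [set omega | A2 (Z omega, D j omega)]) = ((Z omega, D j omega) \in A2).
    by apply/idP/idP; rewrite !inE.
  by case: ifP; rewrite ?mulr1 ?mulr0.
rewrite (indep2_integral (X := Z) (tauYD j) (f := fun z => (\1_A1 z)%:E))//; last first.
  by apply/measurable_EFinP; exact: measurable_indic.
rewrite (indep2_integral (X := Z) (tauYD j)
  (f := fun z => (discount theta z.1.2 * \1_A2 z)%:E)); last 2 first.
- apply/measurable_EFinP; apply: measurable_funM; last exact: measurable_indic.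
  by apply: (measurableT_comp (measurable_discount theta)).
- by move=> z; rewrite lee_fin mulr_ge0.
apply: eq_integral => omega _; move: (Z omega) => [s y].
have [sy|sy] := ltP s y; last first.
  rewrite !integral0_eq// => z _; rewrite indicE memNset ?mulr0//= /A1 /A2/=.
    by case; rewrite ltNge sy.
  by case; rewrite ltNge sy.
have [yt|yt] := leP y theta; last first.
  rewrite !integral0_eq// => z _; first by rewrite /discount/= leNgt yt mul0r mul0r.
  by rewrite indicE memNset//= /A1/= leNgt yt => -[_ []].
have -> : (\int[distribution P (D j)]_z (\1_A1 ((s, y), z))%:E =
   distribution P (D j) `](theta - s)%R, +oo[%classic)%E.
  rewrite -[X in _ = distribution P (D j) X](setIT) -(integral_indic _ measurableT)//.
  apply: eq_integral => z _; rewrite !indicE; congr (nat_of_bool _)%:R%:E.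
  by apply/idP/idP; rewrite !inE /A1/= in_itv/= andbT ltrBlDl; [case=> _ []|].
have -> : (\int[distribution P (D j)]_z (discount theta y * \1_A2 ((s, y), z))%:E =
   (discount theta y)%:E * distribution P (D j) `[(y - s)%R, +oo[%classic)%E.
  rewrite -[X in _ = (_ * distribution P (D j) X)%E](setIT) -(integral_indic _ measurableT)//.
  rewrite -ge0_integralZl//.
  - apply: eq_integral => z _; rewrite !indicE -EFinM; congr (_ * (nat_of_bool _)%:R)%:E.
    by apply/idP/idP; rewrite !inE /A2/= in_itv/= andbT lerBlDl; [case|].
  - by apply/measurable_EFinP; exact: measurable_indic.
  - by rewrite lee_fin.
rewrite Dge ?subr_ge0 ?ltW// Dgt ?subr_ge0 ?(le_trans (ltW sy))//.
rewrite -EFinM /discount yt mul1r -expRD; congr (expR _)%:E; ring.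
Qed.


Lemma integral_setI_ae (D' S : set T) (f : T -> \bar R) :
  measurable D' -> measurable S -> P (~` S) = 0%E -> measurable_fun setT f ->
  (forall x, 0 <= f x)%E ->
  (\int[P]_(x in D') f x = \int[P]_(x in D' `&` S) f x)%E.
Proof.
move=> mD' mS S0 mf f0.
rewrite (ge0_negligible_integral (measurableC mS))//; last exact: measurable_funTS.
by rewrite setDE setCK.
Qed.

Lemma path_straddle (f : nat -> R) (y : R) : f 0%N < y -> (exists k, y <= f k) ->
  exists j, f j < y <= f j.+1.
Proof.
move=> f0 yf; have [[|j] yj jmin] := ex_minnP yf.
  by move: f0; rewrite ltNge yj.
exists j; rewrite yj andbT ltNge; apply/negP => /jmin.
by rewrite ltnn.
Qed.

Lemma straddle_unique (f : nat -> R) (y : R) i j : (forall k, f k < f k.+1) ->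
  f i < y <= f i.+1 -> f j < y <= f j.+1 -> i = j.
Proof.
move=> fS /andP[iy yi] /andP[jy yj]; apply/eqP; rewrite eqn_leq.
apply/andP; split; rewrite leqNgt; apply/negP => /(strict_path_le fS) /= ji.
  by have := lt_le_trans iy (le_trans yj ji); rewrite ltxx.
by have := lt_le_trans jy (le_trans yi ji); rewrite ltxx.
Qed.

(** If no tau_j falls in [Y, theta] and Y <= theta, then exactly one gap
    straddles Y and reaches beyond theta. By [straddle_weight] the probabilities
    of these events, summed over the gaps, give the expectation of the discount,
    as exactly one gap contains Y. *)
Lemma renewal_hits (theta : R) :
  P (hits Y (fun k => tau k : T -> R) theta) =
  (\int[P]_omega (exp_cdf mu theta (Y omega))%:E)%E.
Proof.
have [N [mN N0 good]] : {ae P, forall omega, [/\ 0 < Y omega,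
    forall k, tau k omega < tau k.+1 omega &
    forall x : R, exists k, x <= tau k omega]}.
  by apply: filterS3 Y0 tau_lt renewal_unbounded => omega *; split.
(* All pathwise arguments take place on S, where the events below are
   disjoint; intersecting with S does not change probabilities. *)
pose S := ~` N.
have mS : measurable S by exact: measurableC.
have S0 : P (~` S) = 0%E by rewrite setCK.
have {}good omega : S omega -> [/\ 0 < Y omega,
    forall k, tau k omega < tau k.+1 omega &
    forall x : R, exists k, x <= tau k omega].
  by move=> So; apply: contrapT => nG; apply: So; exact: good.
have aeS : {ae P, forall omega, S omega}.
  exists N; split=> // omega /=; exact: contrapT.
have PS A : measurable A -> P A = P (A `&` S).
  move=> mA; apply: eq_measure_ae => //; first exact: measurableI.
  by apply: filterS aeS => omega So; split=> // -[].
pose A := hits Y (fun k => tau k : T -> R) theta.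
pose B j := [set omega | tau j omega < Y omega <= theta /\ theta < tau j.+1 omega].
pose F j := [set omega | tau j omega < Y omega <= tau j.+1 omega].
pose C := [set omega | Y omega <= theta].
have mA : measurable A by exact: measurable_hits.
have mC : measurable C by exact: measurable_set_le.
have mF j : measurable (F j).
  have -> : F j = [set omega | tau j omega < Y omega] `&`
      [set omega | Y omega <= tau j.+1 omega].
    by apply/seteqP; split=> omega; rewrite /F/=; [move=> /andP|move=> [-> ->]].
  by apply: measurableI; [exact: measurable_set_lt|exact: measurable_set_le].
have mB j : measurable (B j).
  have -> : B j = [set omega | tau j omega < Y omega] `&` C `&`
      [set omega | (cst theta : {mfun T >-> R}) omega < tau j.+1 omega].
    apply/seteqP; split=> omega; rewrite /B /C/=; first by move=> [/andP[? ?] ?].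
    by move=> [[-> ->] ->].
  by do !apply: measurableI => //; exact: measurable_set_lt.
have CE : C `&` S = (A `&` S) `|` \bigcup_j (B j `&` S).
  apply/seteqP; split=> omega.
    move=> [Co So]; have [Yp tS tU] := good _ So.
    have [||j /andP[jY Yj]] := path_straddle (f := tau ^~ omega) (y := Y omega).
    - by rewrite tau0.
    - exact: tU.
    have [jt|tj] := leP (tau j.+1 omega) theta.
      by left; split=> //; exists j.+1; rewrite Yj jt.
    by right; exists j => //; split=> //; split=> //; rewrite jY.
  case=> [[[k /andP[Yk kt]] So]|[j _ [[/andP[_ Yt] _] So]]]; split=> //.
  exact: le_trans Yk kt.
have Btriv : trivIset setT (fun j => B j `&` S).
  apply/trivIsetP => i j _ _ /eqP ij; apply/seteqP; split=> // omega.
  move=> [[[/andP[iY Yt] ti] So] [[/andP[jY _] tj] _]]; apply: ij.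
  have [_ tS _] := good _ So.
  apply: (straddle_unique (y := Y omega) tS); apply/andP; split=> //;
    exact/ltW/(le_lt_trans Yt).
have Ftriv : trivIset setT (fun j => F j `&` S).
  apply/trivIsetP => i j _ _ /eqP ij; apply/seteqP; split=> // omega.
  move=> [[Fi So] [Fj _]]; apply: ij.
  by have [_ tS _] := good _ So; exact: (straddle_unique tS Fi Fj).
have mhY : measurable_fun setT (fun omega => (discount theta (Y omega))%:E).
  by apply/measurable_EFinP; exact: (measurableT_comp (measurable_discount theta)).
have hY0 omega : (0 <= (discount theta (Y omega))%:E)%E by rewrite lee_fin.
have CAB : P C = (P A + \int[P]_omega (discount theta (Y omega))%:E)%E.
  rewrite (PS _ mC) CE measureU//; last 3 first.
  - exact: measurableI.
  - by apply: bigcupT_measurable => j; exact: measurableI.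
  - apply/seteqP; split=> // omega [[[k /andP[Yk kt]] So]].
    move=> [j _ [[/andP[jY Yt] tj] _]]; have [_ tS _] := good _ So.
    have /(strict_path_le tS) /= jk : (j < k)%N.
      rewrite ltnNge; apply/negP => /(strict_path_le tS) /= kj.
      by have := lt_le_trans jY (le_trans Yk kj); rewrite ltxx.
    by have := lt_le_trans tj (le_trans jk kt); rewrite ltxx.
  congr (_ + _)%E; first exact/esym/PS.
  transitivity (\sum_(j <oo) P (B j `&` S))%E.
    have -> : (\sum_(j <oo) P (B j `&` S) =
        \sum_(j <oo | j \in [set: nat]) P (B j `&` S))%E.
      by apply: eq_eseriesl => j; rewrite in_setT.
    by apply: measure_bigcup => // j _; exact: measurableI.
  rewrite (integral_setI_ae measurableT mS)// setTI.
  have SE : S = \bigcup_j (F j `&` S).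
    rewrite -setI_bigcupl; apply/seteqP; split=> omega; last by case.
    move=> So; split=> //; have [Yp tS tU] := good _ So.
    have [||j jY] := path_straddle (f := tau ^~ omega) (y := Y omega).
    - by rewrite tau0.
    - exact: tU.
    by exists j.
  have -> : (\int[P]_(x in S) (discount theta (Y x))%:E =
      \sum_(j <oo) \int[P]_(x in F j `&` S) (discount theta (Y x))%:E)%E.
    rewrite {1}SE; apply: ge0_integral_bigcup => //.
    - by move=> j; exact: measurableI.
    - exact: measurable_funTS.
  apply: eq_eseriesr => j _.
  transitivity (P (B j)); first exact/esym/PS.
  by rewrite straddle_weight -integral_setI_ae.
have Ch : P C = (\int[P]_omega (exp_cdf mu theta (Y omega))%:E +
    \int[P]_omega (discount theta (Y omega))%:E)%E.
  rewrite -ge0_integralD//; last 2 first.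
  - by move=> omega _; rewrite lee_fin; exact: exp_cdf_ge0.
  - apply/measurable_EFinP; apply: measurableT_comp => //.
    exact: measurable_exp_cdf.
  rewrite -[C]setIT -(integral_indic P measurableT)//.
  apply: eq_integral => omega _; rewrite -EFinD; congr EFin.
  rewrite indicE /exp_cdf /discount.
  have -> : (omega \in C) = (Y omega <= theta) by apply/idP/idP; rewrite inE.
  by case: leP => _; rewrite ?mul1r ?mul0r ?subrK ?addr0.
(* Both P C and the unknown probability differ by the integral of the
   discount from a known quantity; that integral is finite and cancels. *)
have hfin : (\int[P]_omega (discount theta (Y omega))%:E)%E \is a fin_num.
  rewrite ge0_fin_numE ?integral_ge0//; apply: (@le_lt_trans _ _ 1%E); last exact: ltry.
  apply: (@le_trans _ _ (P C)); last exact: probability_le1.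
  by rewrite CAB leeDr.
by rewrite -[LHS](addeK _ hfin) -[X in (X - _)%E]CAB Ch addeK.
Qed.

End renewal.

(** * The functions phi_i as integrals *)

Section phi_calculus.
Context {R : realType}.
Variables (lambda mu : R) (k : nat).
Hypothesis lambda0 : 0 < lambda.
Hypothesis lambda_mu : lambda != mu.

Let H (u : R) := expR (mu * u) * (lambda ^+ k.+1 * phi lambda mu k u).

Let HE u : H u = expR (mu * u) * poisson_tail k.+1 (lambda * u) +
  (- (lambda ^+ k.+1 / (lambda - mu) ^+ k.+1)) * poisson_tail k.+1 ((lambda - mu) * u).
Proof.
rewrite /H /phi -/(poisson_tail k.+1 (lambda * u)) -/(poisson_tail k.+1 ((lambda - mu) * u)).
rewrite expRN; field.
have lm : lambda - mu != 0 by rewrite subr_eq0.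
rewrite (gt_eqF (expR_gt0 _)) andTb; apply/andP; split; apply: expf_neq0 => //.
by rewrite gt_eqF.
Qed.

Lemma phi_0 : expR (mu * 0) * (lambda ^+ k.+1 * phi lambda mu k 0) = 0.
Proof. by rewrite -/(H 0) HE !mulr0 poisson_tailS_0 !mulr0 addr0. Qed.

(** The derivatives of the two Poisson tails in phi cancel after the
    multiplication by exp(mu u); only the derivative of this factor survives. *)
Lemma is_derive_phi (u : R) :
  is_derive u 1 (fun u => expR (mu * u) * (lambda ^+ k.+1 * phi lambda mu k u))
    (mu * expR (mu * u) * poisson_tail k.+1 (lambda * u)).
Proof.
have -> : (fun u => expR (mu * u) * (lambda ^+ k.+1 * phi lambda mu k u)) =
   (fun u => expR (mu * u) * poisson_tail k.+1 (lambda * u) +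
  (- (lambda ^+ k.+1 / (lambda - mu) ^+ k.+1)) * poisson_tail k.+1 ((lambda - mu) * u)).
  by apply/funext => v; exact: HE.
pose dtail (c : R) : is_derive u 1 (fun u => poisson_tail k.+1 (c * u)) _ :=
  is_derive_chain (is_derive_poisson_tail k (c * u)) (is_derive_linear c u) erefl.
refine (is_derive_add
  (is_derive_mul (is_derive_expR_linear mu u) (dtail lambda) erefl)
  (is_derive_mul (is_derive_const _ u) (dtail (lambda - mu)) erefl) _).
have -> : expR (- ((lambda - mu) * u)) = expR (mu * u) * expR (- (lambda * u)).
  by rewrite -expRD; congr expR; ring.
have lm : lambda - mu != 0 by rewrite subr_eq0.
have kf : k`!%:R != 0 :> R by rewrite pnatr_eq0 -lt0n fact_gt0.
rewrite !exprMn !exprS; field.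
by rewrite kf lm expf_neq0.
Qed.

End phi_calculus.

Section renewal_phi.
Context {d : measure_display} {T : measurableType d} {R : realType}.
Variable P : probability T R.

(** Up to the factor lambda^(k+1), phi_k is the distribution function of
    Y + Z, where Y is the k-th attack time and Z an independent exponential
    variable of rate mu. *)
Lemma integral_exp_cdf_erlang (lambda mu : R) (k : nat) (Y : {mfun T >-> R}) theta :
  0 < lambda -> 0 < mu -> lambda != mu -> 0 <= theta ->
  {ae P, forall omega, 0 <= Y omega} ->
  (forall u, 0 <= u -> P [set omega | Y omega <= u] =
     (poisson_tail k.+1 (lambda * u))%:E) ->
  (\int[P]_omega (exp_cdf mu theta (Y omega))%:E)%E =
  (lambda ^+ k.+1 * phi lambda mu k theta)%:E.
Proof.
move=> l0 m0 lm t0 Y0 YE.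
rewrite (integral_exp_cdf_primitive
  (G := fun u => poisson_tail k.+1 (lambda * u)) m0 Y0 YE (is_derive_phi k l0 lm)) //.
- by rewrite mulrA -expRD addNr expR0 mul1r.
- exact: continuous_poisson_tail.
- exact: phi_0.
Qed.

End renewal_phi.

(** * Binomial form of the law of the hitting attack *)

Section node_count_algebra.
Context {R : realType}.
Variables (a b : R) (M : nat).

(** The generating polynomial of the geometric law, truncated at degree M: its
    k-th power has the law of the sum of k counts as coefficients below M, and
    only sums below M leave the process inside. *)
Definition geometric_poly : {poly R} :=
  \poly_(l < M) (if l is l'.+1 then a * b ^+ l' else 0).
Local Notation p := geometric_poly.

(** Expanding the k-th power of the polynomial yields one monomial per word of
    counts. *)
Lemma sum_geometric_words k (h : nat -> R) :
  \sum_(f : {ffun 'I_k -> 'I_M} | (\sum_i f i < M)%N)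
     (\prod_i p`_(f i)) * h (\sum_i f i)%N =
  \sum_(m < M) (p ^+ k)`_m * h m.
Proof.
have -> : p ^+ k = \sum_(f : {ffun 'I_k -> 'I_M})
    (\prod_i p`_(f i)) *: 'X^(\sum_i f i).
  have -> : p ^+ k = \prod_(i < k) \sum_(l < M) p`_l *: 'X^l.
    rewrite prodr_const card_ord; congr (_ ^+ _).
    rewrite {1}/p poly_def; apply: eq_bigr => l _.
    by rewrite coef_poly ltn_ord.
  rewrite bigA_distr_bigA/=; apply: eq_bigr => f _.
  by rewrite scaler_prod -expr_sum.
under [RHS]eq_bigr => m _.
  rewrite coef_sum mulr_suml.
  under eq_bigr do rewrite coefZ coefXn.
  over.
rewrite exchange_big/= big_mkcond/=; apply: eq_bigr => f _.
case: ifP => [fM|fM].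
  rewrite (bigD1 (Ordinal fM))//= eqxx mulr1 [X in _ + X]big1 ?addr0// => m mf.
  have /negbTE -> : m != (\sum_i f i)%N :> nat.
    by apply: contra mf => /eqP mf; apply/eqP/val_inj.
  by rewrite mulr0 mul0r.
rewrite big1// => m _; case: eqP => mf; last by rewrite mulr0 mul0r.
by move: fM; rewrite -mf ltn_ord.
Qed.

Lemma coef_geometric_polyX0 k : (p ^+ k.+1)`_0 = 0.
Proof. by rewrite exprS coef0M coef_poly; case: ifP; rewrite mul0r. Qed.

(** The relation (1 - b X) p = a X, which holds below degree M. *)
Lemma coef_geometric_polyXS k m : (m.+1 < M)%N ->
  (p ^+ k.+1)`_m.+1 = b * (p ^+ k.+1)`_m + a * (p ^+ k)`_m.
Proof.
move=> mM; rewrite !exprS !coefM.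
have p0 : p`_0 = 0 by rewrite coef_poly; case: ifP.
rewrite big_ord_recl p0 mul0r add0r.
rewrite [in LHS]big_ord_recl [in RHS]big_ord_recl p0 mul0r add0r/=.
have -> : bump 0 0 = 1%N by [].
have -> : p`_1 = a by rewrite coef_poly (leq_trans _ mM)// mulr1.
rewrite subn1 addrC mulr_sumr; congr (_ + _); apply: eq_bigr => i _.
have iM : (i.+2 < M)%N by apply: leq_trans mM; rewrite !ltnS.
rewrite /bump/= !add1n subSS !coef_poly iM (ltn_trans _ iM)// exprS.
by ring.
Qed.

(** For J < M, the probability that k attacks have at most J nodes, that is, that
    J trials of success probability a contain at least k successes. *)
Definition success_tail k J := \sum_(m < J.+1) (p ^+ k)`_m.

Lemma success_tailS k J : (J.+1 < M)%N ->
  success_tail k.+1 J.+1 = b * success_tail k.+1 J + a * success_tail k J.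
Proof.
move=> JM; rewrite {1}/success_tail big_ord_recl coef_geometric_polyX0 add0r.
rewrite !mulr_sumr -big_split/=; apply: eq_bigr => m _.
by rewrite /bump/= add1n coef_geometric_polyXS// (leq_ltn_trans _ JM).
Qed.

Lemma success_tail0 J : success_tail 0 J = 1.
Proof.
rewrite /success_tail big_ord_recl expr0 coefC eqxx big1 ?addr0// => i _.
by rewrite coefC.
Qed.

Hypothesis b_def : b = 1 - a.

(** Both sides obey Pascal's recursion: the last trial is a failure with
    probability b or a success with probability a. *)
Lemma success_tailB k J : (J < M)%N ->
  success_tail k J - success_tail k.+1 J = 'C(J, k)%:R * a ^+ k * b ^+ (J - k).
Proof.
elim: J k => [|J IH] k JM.
  rewrite /success_tail !big_ord_recl !big_ord0 !addr0 coef_geometric_polyX0 subr0.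
  case: k => [|k]; first by rewrite expr0 coefC eqxx bin0 !mulr1.
  by rewrite coef_geometric_polyX0 bin0n !mul0r.
have JM' := ltnW JM; case: k => [|k].
  rewrite success_tailS// !success_tail0 bin0 expr0 !mul1r subn0 exprS mulr1.
  have := IH 0%N JM'; rewrite success_tail0 bin0 expr0 !mul1r subn0 => <-.
  by rewrite b_def; ring.
rewrite !success_tailS//.
have -> : b * success_tail k.+1 J + a * success_tail k J -
    (b * success_tail k.+2 J + a * success_tail k.+1 J) =
    b * (success_tail k.+1 J - success_tail k.+2 J) +
    a * (success_tail k J - success_tail k.+1 J) by ring.
rewrite !IH// binS natrD subSS exprS.
have [kJ|Jk] := ltnP k J; last by rewrite bin_small// ; ring.
have -> : (J - k = (J - k.+1).+1)%N by rewrite -subSn.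
by rewrite exprS; ring.
Qed.

End node_count_algebra.

Section first_passage_algebra.
Context {R : realType}.
Variables (lambda mu xi a b V : R) (M : nat).
Hypothesis M_gt0 : (0 < M)%N.
Hypothesis b_def : b = 1 - a.

(** The probability that the first k attacks leave the process inside: they have
    m < M nodes, whose weight is below V with probability
    poisson_tail m (xi V). *)
Definition survival k : R :=
  \sum_(m < M) ((geometric_poly a b M) ^+ k)`_m * poisson_tail m (xi * V).

Let pois j : R := expR (- (xi * V)) * ((xi * V) ^+ j / j`!%:R).

(** Splitting the Poisson tail according to the value j of the Poisson variable,
    all values from M - 1 on being put together, exchanges the roles of the
    number of nodes and of the Poisson variable. *)
Lemma survivalE k : survival k =
  (1 - coef_K xi V M) * success_tail a b M k M.-1 +
  \sum_(j < M.-1) pois j * success_tail a b M k j.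
Proof.
have ME (F : nat -> R) : \sum_(m < M) F m = \sum_(m < M.-1.+1) F m.
  by rewrite prednK.
rewrite /survival /success_tail.
rewrite (ME (fun m => (geometric_poly a b M ^+ k)`_m * poisson_tail m (xi * V))).
have tE m : (m < M.-1.+1)%N -> poisson_tail m (xi * V) =
    (1 - coef_K xi V M) + \sum_(j < M.-1 | (m <= j)%N) pois j.
  move=> mM; rewrite /poisson_tail /coef_K !mulr_sumr.
  rewrite (bigID (fun j : 'I_M.-1 => (j < m)%N))/= opprD addrA.
  under [X in _ = _ - X + _]eq_bigl do rewrite -leqNgt.
  rewrite subrK; congr (_ - _).
  rewrite ltnS in mM.
  by rewrite (big_ord_widen _ (fun j => expR (- (xi * V)) * ((xi * V) ^+ j / j`!%:R)) mM).
under eq_bigr => m _ do rewrite tE// mulrDr.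
rewrite big_split/= -mulr_suml; congr (_ + _); first by rewrite mulrC.
under eq_bigr => m _ do rewrite big_mkcond mulr_sumr.
rewrite exchange_big/=; apply: eq_bigr => j _.
have jM : (j.+1 <= M.-1.+1)%N by rewrite ltnS ltnW.
rewrite (big_ord_widen _ (fun m => (geometric_poly a b M ^+ k)`_m) jM).
rewrite mulr_sumr [RHS]big_mkcond/=.
apply: eq_bigr => m _; rewrite ltnS; case: ifP => _; rewrite ?mulr0//.
by rewrite mulrC.
Qed.

Lemma first_passage_sum theta :
  \sum_(k < M) (survival k - survival k.+1) * (lambda ^+ k.+1 * phi lambda mu k theta) =
  lambda * (1 - coef_K xi V M) *
       (\sum_(i < M) coef_c lambda a b M i * phi lambda mu i theta)
     + lambda * expR (- (xi * V)) *
       (\sum_(j < M.-1) (xi * V) ^+ j / j`!%:R *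
          \sum_(i < j.+1) coef_d lambda a b j i * phi lambda mu i theta).
Proof.
have sE k : survival k - survival k.+1 =
    (1 - coef_K xi V M) * ('C(M.-1, k)%:R * a ^+ k * b ^+ (M.-1 - k)) +
    \sum_(j < M.-1) pois j * ('C(j, k)%:R * a ^+ k * b ^+ (j - k)).
  rewrite !survivalE opprD addrACA -mulrBr success_tailB ?prednK// -sumrB.
  congr (_ + _); apply: eq_bigr => j _; rewrite -mulrBr success_tailB//.
  by rewrite (leq_trans (ltn_ord j))// leq_pred.
under eq_bigr => k _ do rewrite sE mulrDl.
rewrite big_split/=; congr (_ + _).
  rewrite mulr_sumr; apply: eq_bigr => i _.
  by rewrite /coef_c exprMn exprS; ring.
under eq_bigr => k _ do rewrite mulr_suml.
rewrite exchange_big/= mulr_sumr; apply: eq_bigr => j _.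
have jM : (j.+1 <= M)%N by rewrite (leq_trans (ltn_ord j))// leq_pred.
rewrite (big_ord_widen _ (fun i => coef_d lambda a b j i * phi lambda mu i theta) jM).
rewrite !mulr_sumr [RHS]big_mkcond/=; apply: eq_bigr => k _.
rewrite ltnS; case: leqP => kj; last by rewrite bin_small//; ring.
by rewrite /coef_d /pois !exprMn exprS; ring.
Qed.

End first_passage_algebra.

(** * Attacks that leave the process inside *)

Section family_sigma_theory.
Context {d : measure_display} {T : measurableType d}.
Context {d' : measure_display} {U : measurableType d'} (I : Type).
Variable X : I -> {mfun T >-> U}.

Lemma family_sigma_algebra : sigma_algebra setT (family_sigma (fun i => X i : T -> U)).
Proof. exact: smallest_sigma_algebra. Qed.

Lemma family_sigma_measurable : family_sigma (fun i => X i : T -> U) `<=` measurable.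
Proof.
apply: smallest_sub; first exact: sigma_algebra_measurable.
by apply: bigcup_sub => i _; exact: preimage_rv_measurable.
Qed.

Lemma preimage_family_sigma i :
  g_sigma_algebra_preimage (X i) `<=` family_sigma (fun i => X i : T -> U).
Proof.
apply: subset_trans (@sub_sigma_algebra _ setT _).
exact: (bigcup_sup (i := i)).
Qed.

End family_sigma_theory.

(** The first k attacks leave the process inside, so that the hitting attack has
    index at least k (indices starting from 0). *)
Definition unhit {R : realType} {S : Type} (n : nat -> S -> nat)
    (w : nat -> nat -> S -> R) (M : nat) (V : R) (k : nat) :=
  [set omega | (\sum_(i < k) n i omega < M)%N /\
               \sum_(i < k) attack_weight n w i omega < V].

Section random_sums.
Context {R : realType} {d : measure_display} {S : measurableType d}.

Lemma measurable_random_sum (N : S -> nat) (u : nat -> S -> R) :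
  measurable_fun setT N -> (forall j, measurable_fun setT (u j)) ->
  measurable_fun setT (fun omega => \sum_(j < N omega) u j omega).
Proof.
move=> mN mu _ A mA; rewrite setTI.
have -> : (fun omega => \sum_(j < N omega) u j omega) @^-1` A =
    \bigcup_l (N @^-1` [set l] `&` (fun omega => \sum_(j < l) u j omega) @^-1` A).
  apply/seteqP; split=> omega /=; first by exists (N omega).
  by case=> l _ [/= <-].
apply: bigcupT_measurable => l; apply: measurableI.
  by rewrite -[_ @^-1` _]setTI; apply: mN.
rewrite -[_ @^-1` _]setTI; exact: measurable_sum.
Qed.

Lemma measurable_unhit (n : nat -> S -> nat) (w : nat -> nat -> S -> R)
    M V k : (forall i, measurable_fun setT (n i)) ->
  (forall i j, measurable_fun setT (w i j)) -> measurable (unhit n w M V k).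
Proof.
move=> mn mw.
have mN : measurable_fun setT (fun omega => \sum_(i < k) n i omega)%N.
  elim: k => [|k IH].
    by under eq_fun do rewrite big_ord0; exact: measurable_cst.
  by under eq_fun do rewrite big_ord_recr/=; exact: measurable_fun_addn.
have mW : measurable_fun setT (fun omega => \sum_(i < k) attack_weight n w i omega).
  by apply: measurable_sum => i; exact: measurable_random_sum.
have -> : unhit n w M V k = (fun omega => \sum_(i < k) n i omega)%N @^-1` `I_M `&`
    [set omega | \sum_(i < k) attack_weight n w i omega < V] by [].
apply: measurableI; last exact: measurable_set_lt.
by rewrite -[_ @^-1` _]setTI; exact: mN.
Qed.

End random_sums.

Lemma measure_big_fin d (T : measurableType d) (R : realType) (P : probability T R)
    (I : finType) (Q : pred I) (F : I -> set T) :
  (forall i, measurable (F i)) ->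
  (forall i j omega, F i omega -> F j omega -> i = j) ->
  P (\bigcup_(i in [set` Q]) F i) = (\sum_(i | Q i) P (F i))%E.
Proof.
move=> mF Fdisj; rewrite measure_fin_bigcup//; last first.
  by move=> i j _ _ [omega [Fi Fj]]; exact: Fdisj Fi Fj.
apply/esym/bigfs; first exact: index_enum_uniq.
by move=> i _; rewrite mem_index_enum.
Qed.

Section almost_sure_union.
Context {d : measure_display} {T : measurableType d} {R : realType}.
Variable P : probability T R.

Lemma measure_big_fin_ae (I : finType) (F : I -> set T) :
  (forall i, measurable (F i)) ->
  {ae P, forall omega, forall i j, F i omega -> F j omega -> i = j} ->
  P (\bigcup_i F i) = (\sum_i P (F i))%E.
Proof.
move=> mF [N [mN N0 Fdisj]].
have aeN : {ae P, forall omega, (~` N) omega}.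
  by exists N; split=> // omega /=; exact: contrapT.
have mFN i : measurable (F i `&` ~` N) by apply: measurableI => //; exact: measurableC.
have PFN i : P (F i) = P (F i `&` ~` N).
  by apply: eq_measure_ae => //; apply: filterS aeN => omega No; split=> // -[].
under [RHS]eq_bigr do rewrite PFN.
have := @measure_big_fin _ _ _ P I xpredT _ mFN; move=> <-.
  apply: eq_measure_ae; [exact: fin_bigcup_measurable|exact: fin_bigcup_measurable|].
  apply: filterS aeN => omega No; split; first by case=> i _ Fi; exists i.
  by case=> i _ [Fi _]; exists i.
move=> i j omega [Fi No] [Fj _]; apply: contrapT => ij; apply: No.
by apply: Fdisj => /= h; exact: ij (h i j Fi Fj).
Qed.

End almost_sure_union.

Section node_counts.
Context {d : measure_display} {T : measurableType d} {R : realType}.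
Variable P : probability T R.
Variables (a : R) (n : nat -> {mfun T >-> nat}).
Hypothesis a_gt0 : 0 < a.
Hypothesis a_lt1 : a < 1.
Hypothesis n_law : iid_geometric P a (fun i => n i : T -> nat).

Lemma measurable_rv_eq (X : {mfun T >-> nat}) l : measurable [set omega | X omega = l].
Proof.
have -> : [set omega | X omega = l] = X @^-1` [set l] by [].
by rewrite -[_ @^-1` _]setTI; exact: measurable_funP.
Qed.

(** The probabilities of the positive values sum to 1. *)
Lemma geometric_0 i : P [set omega | n i omega = 0%N] = 0%E.
Proof.
have b0 : 0 <= 1 - a by rewrite subr_ge0 ltW.
have b1 : 1 - a < 1 by rewrite ltrBlDr ltrDl.
apply: (ereal_le_geometric_eq0 b0 b1) => // N.
pose F (j : 'I_N) := [set omega | n i omega = j.+1].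
have mF j : measurable (F j) by exact: measurable_rv_eq.
have PF : P (\bigcup_(j in [set` (xpredT : pred 'I_N)]) F j) = (1 - (1 - a) ^+ N)%:E.
  rewrite measure_big_fin//; last first.
    by move=> j j' omega; rewrite /F/= => -> [] /val_inj.
  rewrite (eq_bigr (fun j : 'I_N => (a * (1 - a) ^+ j)%:E)); last first.
    by move=> j _; rewrite /F n_law.2.
  rewrite sumEFin -mulr_sumr; congr EFin.
  have := subrXX 1 (1 - a) N; rewrite expr1n => ->; congr (_ * _); first by ring.
  by apply: eq_bigr => j _; rewrite expr1n mul1r.
have -> : ((1 - a) ^+ N)%:E = P (~` \bigcup_(j in [set` (xpredT : pred 'I_N)]) F j).
  rewrite probability_setC; last exact: fin_bigcup_measurable.
  transitivity (1 - (1 - (1 - a) ^+ N)%:E)%E; last by congr (_ - _)%E; exact/esym/PF.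
  by rewrite -EFinB; congr EFin; ring.
apply: le_measure; rewrite ?inE.
- exact: measurable_rv_eq.
- by apply: measurableC; exact: fin_bigcup_measurable.
- by move=> omega /= n0 [j _]; rewrite /F/= n0.
Qed.

Lemma n_gt0_ae : {ae P, forall omega, forall i, (0 < n i omega)%N}.
Proof.
apply/ae_foralln => i; exists [set omega | n i omega = 0%N]; split.
- exact: measurable_rv_eq.
- exact: geometric_0.
- by move=> omega /= /negP; rewrite -eqn0Ngt => /eqP.
Qed.

Variable M : nat.

Lemma prefix_prob k (l : nat -> nat) : (forall i, (l i < M)%N) ->
  P (\bigcap_(i in [set` [fset i in iota 0 k]%fset]) [set omega | n i omega = l i]) =
  (\prod_(i < k) (geometric_poly a (1 - a) M)`_(l i))%:E.
Proof.
move=> lM; have [ni nl] := n_law.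
rewrite (ni _ (fun i => [set omega | n i omega = l i])); last first.
  by move=> i _; exists [set l i] => //; rewrite setTI.
rewrite (eq_bigr (fun i => ((geometric_poly a (1 - a) M)`_(l i))%:E)); last first.
  move=> i _; rewrite coef_poly lM; case: (l i) => [|l']; first exact: geometric_0.
  by rewrite nl.
rewrite prodEFin; congr EFin.
rewrite -[in RHS](big_mkord xpredT (fun i => (geometric_poly a (1 - a) M)`_(l i))).
apply: perm_big; rewrite /index_iota subn0 uniq_perm ?iota_uniq ?fset_uniq//= => i.
by rewrite !inE.
Qed.

End node_counts.

Section unhit_law.
Context {d : measure_display} {T : measurableType d} {R : realType}.
Variable P : probability T R.
Variables (xi a V : R) (M : nat).
Variables (n : nat -> {mfun T >-> nat}) (w : nat -> nat -> {mfun T >-> R}).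
Hypotheses (xi_gt0 : 0 < xi) (a_gt0 : 0 < a) (a_lt1 : a < 1) (V_gt0 : 0 < V).
Hypothesis n_law : iid_geometric P a (fun i => n i : T -> nat).
Let W (p : nat * nat) := w p.1 p.2.
Hypothesis w_law : iid_exponential P xi (fun p => W p : T -> R).
Hypothesis nw_indep : forall A B,
  family_sigma (fun i => n i : T -> nat) A -> family_sigma (fun p => W p : T -> R) B ->
  P (A `&` B) = (P A * P B)%E.

(** The labels of the nodes lost in the first k attacks, when l gives their
    numbers. *)
Definition hit_nodes k (l : nat -> nat) : seq (nat * nat) :=
  [seq (i, j) | i <- iota 0 k, j <- iota 0 (l i)].

Lemma hit_nodes_uniq k l : uniq (hit_nodes k l).
Proof.
apply: allpairs_uniq_dep; first exact: iota_uniq.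
  by move=> i _; exact: iota_uniq.
by move=> [i j] [i' j'] _ _ /= [-> ->].
Qed.

Lemma size_hit_nodes k l : size (hit_nodes k l) = (\sum_(i < k) l i)%N.
Proof.
rewrite size_allpairs_dep -(big_mkord xpredT l) /index_iota subn0.
elim: (iota 0 k) => [|i s IH]; first by rewrite big_nil.
by rewrite big_cons /= IH size_iota.
Qed.

Lemma sum_hit_nodes k l (u : nat -> nat -> R) :
  \sum_(q <- hit_nodes k l) u q.1 q.2 = \sum_(i < k) \sum_(j < l i) u i j.
Proof.
rewrite big_allpairs_dep -[RHS](big_mkord xpredT (fun i => \sum_(j < l i) u i j)).
rewrite /index_iota subn0; apply: eq_bigr => i _.
by rewrite -(big_mkord xpredT (u i)) /index_iota subn0.
Qed.

(** The event splits according to the word f of the counts of the first k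
    attacks; given the word, the weight is that of a fixed set of nodes. *)
Lemma unhit_prob k : P (unhit n w M V k) = (survival xi a (1 - a) V M k)%:E.
Proof.
(* A word of length k, extended by 0. *)
pose ext (f : {ffun 'I_k -> 'I_M}) (i : nat) : nat :=
  if insub i is Some i' then f i' : nat else 0%N.
have extE f (i : 'I_k) : ext f i = f i.
  by rewrite /ext valK.
pose N f : set T :=
  \bigcap_(i in [set` [fset i in iota 0 k]%fset]) [set omega | n i omega = ext f i].
pose Wt f : set T := [set omega | \sum_(q <- hit_nodes k (ext f)) W q omega < V].
have mN f : measurable (N f).
  by apply: fin_bigcap_measurable; [exact: finite_fset|move=> i _; exact: measurable_rv_eq].
have mWt f : measurable (Wt f).
  by apply: measurable_set_lt => //; exact: measurable_sum.
have NE f omega : N f omega <-> forall i : 'I_k, n i omega = f i.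
  split=> [h i|h i /=].
    by rewrite -extE; apply: (h i); rewrite /= !inE mem_iota/=.
  rewrite !inE mem_iota/= add0n => ik.
  by rewrite -[i]/(nat_of_ord (Ordinal ik)) extE h.
have -> : unhit n w M V k =
    \bigcup_(f in [set` (fun f : {ffun 'I_k -> 'I_M} => (\sum_i f i < M)%N)]) (N f `&` Wt f).
  have WtE f omega : N f omega -> Wt f omega <-> \sum_(i < k) attack_weight n w i omega < V.
    move=> /NE Nf; rewrite /Wt /= (sum_hit_nodes k (ext f) (fun i j => w i j omega)).
    suff -> : \sum_(i < k) \sum_(j < ext f i) w i j omega =
      \sum_(i < k) attack_weight n w i omega by [].
    by apply: eq_bigr => i _; rewrite /attack_weight Nf extE.
  apply/seteqP; split=> omega.
    move=> [nM WV]; have nlt (i : 'I_k) : (n i omega < M)%N.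
      by apply: leq_ltn_trans nM; rewrite (bigD1 i)//= leq_addr.
    pose f := [ffun i : 'I_k => Ordinal (nlt i)].
    have Nf : N f omega by apply/NE => i; rewrite ffunE.
    exists f => /=.
      rewrite unfold_in (eq_bigr (fun i : 'I_k => n i omega)) // => i _.
      by rewrite ffunE.
    by split=> //; apply/(WtE f).
  move=> [f]; rewrite /= unfold_in => fM [Nf Wf]; split.
    rewrite (eq_bigr (fun i : 'I_k => nat_of_ord (f i))) // => i _.
    exact: (NE f omega).1.
  by apply/(WtE f).
rewrite (measure_big_fin P); last 2 first.
- by move=> f; exact: measurableI.
- move=> f g omega [/NE Nf _] [/NE Ng _]; apply/ffunP => i; apply/val_inj => /=.
  by rewrite -Nf -Ng.
rewrite /survival.
rewrite -(sum_geometric_words a (1 - a) M k (fun m => poisson_tail m (xi * V))) -sumEFin.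
apply: eq_bigr => f fM.
rewrite nw_indep; last 2 first.
- apply: (@fin_bigcap_measurable _ (g_sigma_algebraType
     (\bigcup_(i in [set: nat]) g_sigma_algebra_preimage (n i)))).
    exact: finite_fset.
  move=> i _; apply: (preimage_family_sigma (X := n) (i := i)).
  by exists [set ext f i] => //; rewrite setTI.
- apply: (@measurable_set_lt _ _ (g_sigma_algebraType
     (\bigcup_(p in [set: nat * nat]) g_sigma_algebra_preimage (W p)))) => //.
  apply: measurable_sum => p; apply: measurable_fun_generated.
  exact: (preimage_family_sigma (X := W)).
rewrite EFinM; congr (_ * _)%E.
  rewrite (prefix_prob a_gt0 a_lt1 n_law (M := M)); last first.
    move=> i; rewrite /ext; case: insubP => [j _ _|_]; first exact: ltn_ord.
    exact: leq_ltn_trans fM.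
  by congr EFin; apply: eq_bigr => i _; rewrite extE.
have [_ ->//] := sum_exponential xi_gt0 w_law (hit_nodes_uniq k (ext f)).
rewrite size_hit_nodes; congr (poisson_tail _ _)%:E.
by apply: eq_bigr => i _; rewrite extE.
Qed.

End unhit_law.

(** * Independence in the attack model *)

Section attack_model_independence.
Context {d : measure_display} {T : measurableType d} {R : realType}.
Variable P : probability T R.
Variables (lambda mu : R).
Variables (t : nat -> {mfun T >-> R}) (n : nat -> {mfun T >-> nat}).
Variables (w : nat -> nat -> {mfun T >-> R}) (tau : nat -> {mfun T >-> R}).
Hypotheses (lambda_gt0 : 0 < lambda) (mu_gt0 : 0 < mu) (lambda_mu : lambda != mu).
Hypothesis t_law : poisson_points P lambda (fun k => t k : T -> R).
Hypothesis tau0 : forall omega, tau 0%N omega = 0.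
Hypothesis tau_lt : {ae P, forall omega, forall k, tau k omega < tau k.+1 omega}.
Let W (p : nat * nat) := w p.1 p.2.
Let D k : {mfun T >-> R} := tau k.+1 - tau k.
Hypothesis tau_law : iid_exponential P mu (fun k => D k : T -> R).
Let F (i : 'I_4) : set_system T := nth set0
     [:: family_sigma (fun k => t k : T -> R);
         family_sigma (fun k => n k : T -> nat);
         family_sigma (fun p => W p : T -> R);
         family_sigma (fun k => D k : T -> R)] i.
Hypothesis indep : mutually_independent P F.

Lemma four_sigma_algebra i : sigma_algebra setT (F i).
Proof.
by case: i => [[|[|[|[|//]]]] ?]; exact: family_sigma_algebra.
Qed.

Lemma four_measurable i : F i `<=` measurable.
Proof.
by case: i => [[|[|[|[|//]]]] ?]; exact: family_sigma_measurable.
Qed.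

Let i0 : 'I_4 := inord 0.
Let i1 : 'I_4 := inord 1.
Let i2 : 'I_4 := inord 2.
Let i3 : 'I_4 := inord 3.

Let F0 : F i0 = family_sigma (fun k => t k : T -> R).
Proof. by rewrite /F inordK. Qed.
Let F1 : F i1 = family_sigma (fun k => n k : T -> nat).
Proof. by rewrite /F inordK. Qed.
Let F2 : F i2 = family_sigma (fun p => W p : T -> R).
Proof. by rewrite /F inordK. Qed.
Let F3 : F i3 = family_sigma (fun k => D k : T -> R).
Proof. by rewrite /F inordK. Qed.

Lemma count_weight_indep A B :
  family_sigma (fun i => n i : T -> nat) A ->
  family_sigma (fun p => W p : T -> R) B -> P (A `&` B) = (P A * P B)%E.
Proof.
rewrite -F1 -F2; apply: (distinct_indep four_sigma_algebra four_measurable indep).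
by rewrite -val_eqE /= !inordK.
Qed.

Lemma point_gap_indep A B :
  family_sigma (fun k => t k : T -> R) A ->
  family_sigma (fun k => D k : T -> R) B -> P (A `&` B) = (P A * P B)%E.
Proof.
rewrite -F0 -F3; apply: (distinct_indep four_sigma_algebra four_measurable indep).
by rewrite -val_eqE /= !inordK.
Qed.

Lemma tau_sum j omega : tau j omega = \sum_(i < j) D i omega.
Proof.
elim: j => [|j IH]; first by rewrite big_ord0 tau0.
by rewrite big_ord_recr/= -IH /D/= addrC subrK.
Qed.

(** tau j is the sum of the gaps before the j-th one. *)
Lemma past_gap_indep j A B : measurable A -> measurable B ->
  P (tau j @^-1` A `&` D j @^-1` B) = (P (tau j @^-1` A) * P (D j @^-1` B))%E /\
  family_sigma (fun k => D k : T -> R) (tau j @^-1` A `&` D j @^-1` B) /\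
  family_sigma (fun k => D k : T -> R) (tau j @^-1` A).
Proof.
move=> mA mB.
pose Fd i := g_sigma_algebra_preimage (D i).
have Fs i : sigma_algebra setT (Fd i) by exact: sigma_algebra_preimage_rv.
have Fm i : Fd i `<=` measurable by exact: preimage_rv_measurable.
pose G := \bigcup_(i in `I_j) Fd i.
have tauG : <<s G >> (tau j @^-1` A).
  have m : measurable_fun [set: g_sigma_algebraType G] (fun omega => \sum_(i < j) D i omega).
    apply: measurable_sum => i; apply: measurable_fun_generated.
    apply: (subset_trans _ (@sub_sigma_algebra _ setT G)).
    by apply: (bigcup_sup (i := (i : nat))) => /=.
  have := m measurableT A mA; rewrite setTI; congr (measurable _).
  by congr (_ @^-1` A); apply/funext => omega; rewrite -tau_sum.
have tauF : family_sigma (fun k => D k : T -> R) (tau j @^-1` A).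
  by apply: sub_sigma_algebra2 tauG => E [i _ Ei]; exists i.
have DF : family_sigma (fun k => D k : T -> R) (D j @^-1` B).
  by apply: (preimage_family_sigma (X := D) (i := j)); exists B => //; rewrite setTI.
split; last split => //.
- apply: (grouping_indep Fs Fm tau_law.1 (J1 := `I_j) (J2 := [set j])) => //.
  + by move=> i /= [ij iE]; rewrite iE ltnn in ij.
  + by apply: sub_sigma_algebra; exists j => //; exists B => //; rewrite setTI.
- exact: (@measurableI _ (g_sigma_algebraType
     (\bigcup_(k in [set: nat]) g_sigma_algebra_preimage (D k)))).
Qed.

Lemma past_point_gap_indep j k :
  indep2 P (fun omega => (tau j omega, t k omega)) (D j).
Proof.
apply: indep2_pair => A B C mA mB mC.
have [PAC [FAC FA]] := past_gap_indep j mA mC.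
have FB : family_sigma (fun k => t k : T -> R) (t k @^-1` B).
  by apply: (preimage_family_sigma (X := t) (i := k)); exists B => //; rewrite setTI.
rewrite [_ `&` t k @^-1` B]setIC -setIA.
transitivity (P (t k @^-1` B) * P (tau j @^-1` A `&` D j @^-1` C))%E.
  exact: point_gap_indep.
rewrite PAC muleA; congr (_ * _)%E.
by apply/esym; exact: point_gap_indep.
Qed.

Lemma t_gt0_ae k : {ae P, forall omega, 0 < t k omega}.
Proof.
have [tS _ _] := t_law; apply: filterS tS => omega [t0 tS].
exact: lt_le_trans t0 (strict_path_le tS (leq0n k)).
Qed.

(** [renewal_hits] applies because the gap after tau_j is independent of the
    pair (tau_j, t_k). *)
Lemma hits_prob k theta : 0 <= theta ->
  P (hits (t k) (fun j => tau j : T -> R) theta) = (lambda ^+ k.+1 * phi lambda mu k theta)%:E.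
Proof.
move=> theta0.
rewrite (renewal_hits mu_gt0 tau0 tau_lt tau_law (t_gt0_ae k)); last first.
  by move=> j; exact: past_point_gap_indep.
apply: integral_exp_cdf_erlang => //.
  by apply: filterS (t_gt0_ae k) => omega /ltW.
by move=> u u0; exact: (poisson_points_cdf lambda_gt0 t_law).
Qed.

Let sub4 (J : set 'I_4) (i : 'I_4) : J i -> F i `<=` <<s \bigcup_(i in J) F i >>.
Proof.
move=> Ji; apply: subset_trans (@sub_sigma_algebra _ setT _).
exact: (bigcup_sup (i := i)).
Qed.

Lemma unhit_hits_indep (M : nat) (V : R) k theta :
  P ((unhit n w M V k `\` unhit n w M V k.+1) `&`
     hits (t k) (fun j => tau j : T -> R) theta) =
  (P (unhit n w M V k `\` unhit n w M V k.+1) *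
   P (hits (t k) (fun j => tau j : T -> R) theta))%E.
Proof.
apply: (grouping_indep four_sigma_algebra four_measurable indep
  (J1 := [set i | i = i1 \/ i = i2]) (J2 := [set i | i = i0 \/ i = i3])).
- by move=> i /= [[->|->] [|] /(congr1 val)]; rewrite /= !inordK.
- set G := \bigcup_(i in _) F i.
  have m j : @measurable _ (g_sigma_algebraType G) (unhit n w M V j).
    apply: measurable_unhit => [i|i i'].
      apply: measurable_fun_generated.
      apply: subset_trans (preimage_family_sigma (X := n) (i := i)) _.
      by rewrite -F1; apply: sub4; left.
    apply: measurable_fun_generated.
    apply: subset_trans (preimage_family_sigma (X := W) (i := (i, i'))) _.
    by rewrite -F2; apply: sub4; right.
  exact: (@measurableD _ (g_sigma_algebraType G)).
- set G := \bigcup_(i in _) F i.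
  have mt : measurable_fun [set: g_sigma_algebraType G] (t k).
    apply: measurable_fun_generated.
    apply: subset_trans (preimage_family_sigma (X := t) (i := k)) _.
    by rewrite -F0; apply: sub4; left.
  have mtau j : measurable_fun [set: g_sigma_algebraType G] (tau j).
    have -> : tau j = (fun omega => \sum_(i < j) D i omega) :> (T -> R).
      by apply/funext => omega; exact: tau_sum.
    apply: measurable_sum => i; apply: measurable_fun_generated.
    apply: subset_trans (preimage_family_sigma (X := D) (i := i)) _.
    by rewrite -F3; apply: sub4; right.
  exact: (measurable_hits _ mt mtau).
Qed.

End attack_model_independence.

(** * Paths of the model *)

Section first_index_theory.
Variable Q : nat -> Prop.

Lemma first_index_Some k : first_index Q = Some k <-> Q k /\ forall i, (i < k)%N -> ~ Q i.
Proof.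
rewrite /first_index; case: pselect => [h|h].
  case: ex_minnP => m /asboolP Qm mmin; split.
    by case=> <-; split=> // i im /asboolP /mmin; rewrite leqNgt im.
  case=> Qk kmin; congr Some; apply/eqP; rewrite eqn_leq; apply/andP; split.
    by apply: mmin; exact/asboolP.
  by rewrite leqNgt; apply/negP => /kmin.
by split=> // -[Qk _]; exfalso; apply: h; exists k; exact/asboolP.
Qed.

End first_index_theory.

Section passage_paths.
Context {R : realType} {T : Type}.
Variables (t : nat -> T -> R) (n : nat -> T -> nat) (w : nat -> nat -> T -> R).
Variables (tau : nat -> T -> R) (M : nat) (V : R) (omega : T).

Lemma passage_time_leE theta :
  (passage_time t n w tau M V omega <= theta%:E)%E <->
  exists k, [/\ observed_out t n w tau M V omega k,
    forall i, (i < k)%N -> ~ observed_out t n w tau M V omega i &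
    tau k omega <= theta].
Proof.
rewrite /passage_time; split.
  case E : passage_index => [k|]; last by rewrite leye_eq.
  move/first_index_Some : E => [Qk kmin]; rewrite lee_fin => kt.
  by exists k; split.
case=> k [Qk kmin kt].
by rewrite (_ : passage_index _ _ _ _ _ _ _ = Some k) ?lee_fin//; apply/first_index_Some.
Qed.

Hypothesis tau_lt : forall k, tau k omega < tau k.+1 omega.

(** Since tau increases, any observation outside that is made by time theta
    bounds the first one. *)
Lemma passage_time_le_observed theta :
  (passage_time t n w tau M V omega <= theta%:E)%E <->
  exists2 k, observed_out t n w tau M V omega k & tau k omega <= theta.
Proof.
rewrite passage_time_leE; split; first by case=> k [Qk _ kt]; exists k.
case=> k Qk kt.
have exQ : exists i, `[< observed_out t n w tau M V omega i >].
  by exists k; exact/asboolP.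
have [m /asboolP Qm mmin] := ex_minnP exQ.
exists m; split=> //.
  by move=> i im /asboolP /mmin; rewrite leqNgt im.
apply: le_trans kt; apply: (strict_path_le tau_lt).
by apply: mmin; exact/asboolP.
Qed.

Hypothesis t_lt : forall k, t k omega < t k.+1 omega.
Hypothesis w_ge0 : forall i j, 0 <= w i j omega.

Lemma attack_weight_ge0 k : 0 <= attack_weight n w k omega.
Proof. by apply: sumr_ge0 => j _. Qed.

Lemma esum_initial (f : nat -> R) k s : (forall i, 0 <= f i) -> t k omega <= s ->
  ((\sum_(i < k.+1) f i)%:E <= \esum_(i in [set i | (t i omega <= s)%R]) (f i)%:E)%E.
Proof.
move=> f0 ts; apply: esum_ge; exists `I_k.+1.
  split; first exact: finite_II.
  move=> i /=; rewrite ltnS => ik; apply: le_trans ts.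
  exact: (strict_path_le t_lt ik).
by rewrite -sumEFin -(fsbig_ord _ _ (fun i => (f i)%:E)).
Qed.

(** The attacks up to time s are among the first k ones, so the sum is over a
    finite set. *)
Lemma esum_before (f : nat -> R) k s : (forall i, 0 <= f i) -> s < t k omega ->
  (\esum_(i in [set i | (t i omega <= s)%R]) (f i)%:E <= (\sum_(i < k) f i)%:E)%E.
Proof.
move=> f0 st; apply: (@le_trans _ _ (\esum_(i in `I_k) (f i)%:E)%E).
  apply: le_ereal_sup => _ [X [fX Xs] <-]; exists X => //; split=> // i /Xs /= ts.
  rewrite ltnNge; apply/negP => /(strict_path_le t_lt) /= h.
  by have := lt_le_trans st (le_trans h ts); rewrite ltxx.
rewrite esum_fset//; last by move=> i _; rewrite lee_fin.
by rewrite -sumEFin -(fsbig_ord _ _ (fun i => (f i)%:E)).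
Qed.

(** At time s the process has suffered at least the first k.+1 attacks if
    t_k <= s, and at most the first k ones otherwise. *)
Lemma out_after_hitting_attack k s : unhit n w M V k omega -> ~ unhit n w M V k.+1 omega ->
  ~ ((`[0%:E, M%:R%:E[ `*` `[0%:E, V%:E[)%classic
      (nodes_lost t n s omega, weight_lost t n w s omega)) <-> t k omega <= s.
Proof.
move=> [nM WV] nk.
have n0 i : 0 <= (n i omega)%:R :> R by rewrite ler0n.
have [ts|st] := leP (t k omega) s.
  split=> // _ [/=]; rewrite !in_itv/= => /andP[_ nlt] /andP[_ wlt]; apply: nk; split.
    have := le_lt_trans (esum_initial n0 ts) nlt.
    by rewrite lte_fin -natr_sum ltr_nat.
  by have := le_lt_trans (esum_initial attack_weight_ge0 ts) wlt; rewrite lte_fin.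
split=> // nout; exfalso; apply: nout; split => /=; rewrite in_itv/=; apply/andP; split.
- by apply: esum_ge0 => i _; rewrite lee_fin.
- apply: (le_lt_trans (esum_before n0 st)).
  by rewrite lte_fin -natr_sum ltr_nat.
- by apply: esum_ge0 => i _; rewrite lee_fin attack_weight_ge0.
- by apply: (le_lt_trans (esum_before attack_weight_ge0 st)); rewrite lte_fin.
Qed.

Hypothesis n_gt0 : forall i, (0 < n i omega)%N.
Hypotheses (M_gt0 : (0 < M)%N) (V_gt0 : 0 < V).

(** Every attack takes at least one node, so M attacks suffice. *)
Lemma exists_hitting_attack :
  exists2 k, (k < M)%N & unhit n w M V k omega /\ ~ unhit n w M V k.+1 omega.
Proof.
have u0 : unhit n w M V 0 omega by split; rewrite big_ord0.
have uM : ~ unhit n w M V M omega.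
  case=> h _; move: h; apply/negP; rewrite -leqNgt.
  rewrite -[leqLHS]card_ord -sum1_card; exact: leq_sum.
have exU : exists k, ~~ `[< unhit n w M V k omega >] by exists M; exact/asboolPn.
have [[|k] /asboolPn uk kmin] := ex_minnP exU; first by case: uk.
exists k; first by apply: kmin; exact/asboolPn.
split=> //; apply: contrapT => /asboolPn /kmin.
by rewrite ltnn.
Qed.

Lemma unhit_antitone i j : (i <= j)%N -> unhit n w M V j omega -> unhit n w M V i omega.
Proof.
move=> ij [nM WV]; split.
  apply: leq_ltn_trans nM; rewrite (big_ord_widen _ (fun i => n i omega) ij) big_mkcond/=.
  by apply: leq_sum => l _; case: ifP.
apply: le_lt_trans WV.
rewrite (big_ord_widen _ (fun i => attack_weight n w i omega) ij) big_mkcond/=.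
by apply: ler_sum => l _; case: ifP => // _; exact: attack_weight_ge0.
Qed.

Lemma hitting_attack_unique i j :
  unhit n w M V i omega -> ~ unhit n w M V i.+1 omega ->
  unhit n w M V j omega -> ~ unhit n w M V j.+1 omega -> i = j.
Proof.
move=> ui ui1 uj uj1; apply/eqP; rewrite eqn_leq; apply/andP; split; rewrite leqNgt;
  apply/negP => ij.
  by apply: uj1; exact: unhit_antitone ui.
by apply: ui1; exact: unhit_antitone uj.
Qed.

Lemma passage_time_le_hits theta :
  (passage_time t n w tau M V omega <= theta%:E)%E <->
  exists2 k, (k < M)%N & [/\ unhit n w M V k omega, ~ unhit n w M V k.+1 omega &
    hits (t k) tau theta omega].
Proof.
rewrite passage_time_le_observed; split.
  have [k kM [uk uk1]] := exists_hitting_attack.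
  case=> j /(out_after_hitting_attack _ uk uk1) tk jt; exists k => //; split=> //.
  by exists j; rewrite tk.
case=> k kM [uk uk1 [j /andP[tk jt]]]; exists j => //.
exact/(out_after_hitting_attack _ uk uk1).
Qed.

End passage_paths.

(** * Measurability of the passage time *)

Section passage_measurability.
Context {d : measure_display} {T : measurableType d} {R : realType}.

(** No sign is assumed on f: the sum is the supremum over the countably many
    finite sets of indices, enumerated by pickling, each of them being cut down
    to the indices that are selected at omega. *)
Lemma measurable_esum_random (s : nat -> T -> bool) (f : nat -> T -> R) :
  (forall k, measurable_fun setT (s k)) -> (forall k, measurable_fun setT (f k)) ->
  measurable_fun setT (fun omega => \esum_(k in [set k | s k omega]) (f k omega)%:E)%E.
Proof.
move=> ms mf.
pose X (m : nat) : {fset nat} := odflt fset0%fset (choice.unpickle m).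
pose g (m : nat) omega : \bar R :=
  (\sum_(k <- X m) if s k omega then f k omega else 0)%:E.
have -> : (fun omega => \esum_(k in [set k | s k omega]) (f k omega)%:E)%E =
    (fun omega => esups (g ^~ omega) 0%N).
  apply/funext => omega; rewrite /esups /esum; congr ereal_sup.
  apply/seteqP; split=> [_ [A [fA As] <-]|_ [m _ <-]].
    exists (choice.pickle (fset_set A)) => //.
    rewrite /g /X choice.pickleK/= fsbig_finite// -sumEFin.
    apply: eq_big_seq => k; rewrite in_fset_set// inE => Ak.
    by rewrite (As _ Ak).
  pose Q k := (k \in X m) && s k omega.
  exists [set` Q]; first split.
  - by apply: (sub_finite_set _ (finite_fset (X m))) => k /andP[].
  - by move=> k /andP[].
  rewrite -(@bigfs _ _ _ _ (X m) Q) ?fset_uniq//; last by move=> k /andP[-> _].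
  rewrite /g -sumEFin big_mkcond/=; apply: eq_big_seq => k kX.
  by rewrite /Q kX; case: (s k omega).
apply: measurable_fun_esups => m.
apply/measurable_EFinP; apply: measurable_sum => k.
by apply: measurable_fun_if => //; apply: measurable_funTS.
Qed.

Variables (t : nat -> T -> R) (n : nat -> T -> nat) (w : nat -> nat -> T -> R).
Variables (tau : nat -> T -> R) (M : nat) (V : R).
Hypothesis mt : forall k, measurable_fun setT (t k).
Hypothesis mn : forall k, measurable_fun setT (n k).
Hypothesis mw : forall i j, measurable_fun setT (w i j).
Hypothesis mtau : forall k, measurable_fun setT (tau k).

Lemma measurable_observed_out k :
  measurable [set omega | observed_out t n w tau M V omega k].
Proof.
have mN : measurable_fun setT (fun omega => nodes_lost t n (tau k omega) omega).
  apply: measurable_esum_random => i; first exact: measurable_fun_ler.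
  by apply: (measurableT_comp (f := fun m : nat => m%:R : R)).
have mW : measurable_fun setT (fun omega => weight_lost t n w (tau k omega) omega).
  apply: measurable_esum_random => i; first exact: measurable_fun_ler.
  exact: measurable_random_sum.
have -> : [set omega | observed_out t n w tau M V omega k] =
    ~` ((fun omega => nodes_lost t n (tau k omega) omega) @^-1` `[0%:E, M%:R%:E[%classic `&`
        (fun omega => weight_lost t n w (tau k omega) omega) @^-1` `[0%:E, V%:E[%classic) by [].
apply: measurableC; apply: measurableI; rewrite -[_ @^-1` _]setTI.
- by apply: mN => //; exact: emeasurable_itv.
- by apply: mW => //; exact: emeasurable_itv.
Qed.

(** The event must be measurable itself, and not only almost equal to a
    measurable one: the paths on which tau or t fails to increase are included
    here. *)
Lemma measurable_passage_time_le theta :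
  measurable [set omega | (passage_time t n w tau M V omega <= theta%:E)%E].
Proof.
pose Q k := [set omega | observed_out t n w tau M V omega k].
have -> : [set omega | (passage_time t n w tau M V omega <= theta%:E)%E] =
    \bigcup_k (Q k `&` \bigcap_(i in `I_k) ~` Q i `&` [set omega | tau k omega <= theta]).
  apply/seteqP; split=> omega.
    by move=> /passage_time_leE[k [Qk kmin kt]]; exists k.
  by case=> k _ [[Qk kmin] kt]; apply/passage_time_leE; exists k.
apply: bigcupT_measurable => k; apply: measurableI; first apply: measurableI.
- exact: measurable_observed_out.
- apply: fin_bigcap_measurable; first exact: finite_II.
  by move=> i _; apply: measurableC; exact: measurable_observed_out.
- exact: measurable_set_le.
Qed.

End passage_measurability.

(** * The law of the first observed passage time *)

Theorem theorem3p7 (R : realType) (d : measure_display) (T : measurableType d)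
  (P : probability T R)
  (lambda mu xi a b V : R) (M : nat)
  (lambda_gt0 : 0 < lambda) (mu_gt0 : 0 < mu) (xi_gt0 : 0 < xi)
  (a_gt0 : 0 < a) (a_lt1 : a < 1) (b_def : b = 1 - a)
  (M_gt0 : (0 < M)%N) (V_gt0 : 0 < V)
  (t : nat -> {RV P >-> R}) (n : nat -> {RV P >-> nat})
  (w : nat -> nat -> {RV P >-> R}) (tau : nat -> {RV P >-> R})
  (t_law : poisson_points P lambda t)
  (n_law : iid_geometric P a n)
  (w_law : iid_exponential P xi (fun p : nat * nat => w p.1 p.2 : T -> R))
  (tau0 : forall omega, tau 0%N omega = 0)
  (tau_lt : {ae P, forall omega, forall k, tau k omega < tau k.+1 omega})
  (tau_law : iid_exponential P mu
     (fun (k : nat) (omega : T) => tau k.+1 omega - tau k omega))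
  (indep : mutually_independent P (fun i : 'I_4 => nth set0
     [:: family_sigma t;
         family_sigma n;
         family_sigma (fun p : nat * nat => w p.1 p.2 : T -> R);
         family_sigma
           (fun (k : nat) (omega : T) => tau k.+1 omega - tau k omega)] i))
  (distinct : uniq [:: lambda; mu; lambda / b])
  (theta : R) (theta_ge0 : 0 <= theta) :
  P [set omega | (passage_time t n w tau M V omega <= theta%:E)%E] =
    (lambda * (1 - coef_K xi V M) *
       (\sum_(i < M) coef_c lambda a b M i * phi lambda mu i theta)
     + lambda * expR (- (xi * V)) *
       (\sum_(j < M.-1) (xi * V) ^+ j / j`!%:R *
          \sum_(i < j.+1) coef_d lambda a b j i * phi lambda mu i theta))%:E.
Proof.
have lambda_mu : lambda != mu.
  by move: distinct; rewrite /= !inE negb_or => /andP[/andP[]].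
(* The hitting attack is t k exactly on U k minus U k.+1, and H k says that
   an observation in [t k, theta] then reveals it. *)
pose U k := unhit n w M V k : set T.
have mU k : measurable (U k) by exact: measurable_unhit.
pose H k := hits (t k) (fun j => tau j : T -> R) theta.
have mH k : measurable (H k) by exact: measurable_hits.
have t_lt : {ae P, forall omega, forall k, t k omega < t k.+1 omega}.
  by have [h _ _] := t_law; apply: filterS h => omega [].
have n_gt0 := n_gt0_ae a_gt0 a_lt1 n_law.
have w_ge0 : {ae P, forall omega, forall i j, 0 <= w i j omega}.
  apply/ae_foralln => i; apply/ae_foralln => j.
  exact: (exponential_ge0_ae (w_law.2 (i, j))).
have U_anti : {ae P, forall omega, forall i j, (i <= j)%N -> U j omega -> U i omega}.
  by apply: filterS w_ge0 => omega w0 i j; exact: unhit_antitone.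
have PU k : P (U k) = (survival xi a b V M k)%:E.
  rewrite b_def; apply: (unhit_prob M xi_gt0 a_gt0 a_lt1 V_gt0 n_law w_law).
  exact: (count_weight_indep indep).
pose E (k : 'I_M) := (U k `\` U k.+1) `&` H k.
have mE k : measurable (E k) by apply: measurableI => //; exact: measurableD.
have -> : P [set omega | (passage_time t n w tau M V omega <= theta%:E)%E] =
    P (\bigcup_k E k).
  apply: eq_measure_ae.
  - exact: measurable_passage_time_le.
  - exact: fin_bigcup_measurable.
  apply: filterS (filterI (filterI t_lt tau_lt) (filterI n_gt0 w_ge0)).
  move=> omega [[tl taul] [n0 w0]].
  apply: (iff_trans (passage_time_le_hits (t := fun k => t k : T -> R)
    (n := fun k => n k : T -> nat) (w := fun i j => w i j : T -> R)
    (tau := fun k => tau k : T -> R) taul tl w0 n0 M_gt0 V_gt0 theta)); split.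
    by case=> k kM [uk uk1 hk]; exists (Ordinal kM).
  by case=> k _ [[uk uk1] hk]; exists k.
rewrite measure_big_fin_ae//; last first.
  apply: filterS w_ge0 => omega w0 i j [[ui ui1] _] [[uj uj1] _].
  by apply/val_inj; exact: (hitting_attack_unique w0 ui ui1 uj uj1).
rewrite -(first_passage_sum lambda mu xi V M_gt0 b_def theta) -sumEFin.
apply: eq_bigr => k _.
transitivity (P (U k `\` U k.+1) * P (H k))%E.
  exact: (unhit_hits_indep tau0 indep).
have -> : P (H k) = (lambda ^+ k.+1 * phi lambda mu k theta)%:E.
  exact: (hits_prob lambda_gt0 mu_gt0 lambda_mu t_law tau0 tau_lt tau_law indep).
have -> : P (U k `\` U k.+1) = (survival xi a b V M k - survival xi a b V M k.+1)%:E.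
  rewrite measureD//; last by rewrite -ge0_fin_numE// fin_num_measure.
  transitivity (P (U k) - P (U k.+1))%E; last by rewrite !PU EFinB.
  congr (_ - _)%E; apply: eq_measure_ae => //; first exact: measurableI.
  by apply: filterS U_anti => omega anti; split=> [[]//|u1]; split=> //; exact: anti u1.
by rewrite -EFinM.
Qed.
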